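(* Assume that $\mathrm{ZF}$ is consistent. Then $\mathrm{IZF}_{Ref}$ does not prove the statement ''every Cauchy sequence of reals has a limit'', where ''real'' means Cauchy real, i.e. equivalence class of sequence-modulus pairs, and the limit is required to be a real in the same sense.
   Context: $\mathrm{IZF}_{Ref}$ is the theory in first-order intuitionistic logic with equality, in the language $\{\in\}$, with axioms: Extensionality, Empty Set, Pairing, Union, Infinity, Power Set, the Set Induction schema $(\forall x\,((\forall y\in x\;\phi(y))\to\phi(x)))\to\forall x\,\phi(x)$, the full Separation schema, and the Reflection schema: for every formula $\phi(x)$ (possibly with parameters) and every set $z$ there is a transitive set $Z$ containing $z$ and the parameters such that for all $x\in Z$, $\phi(x)$ holds iff $\phi(x)$ holds relativized to $Z$. (It is IZF with Collection replaced by Reflection.) The following notions are formalized in the language of set theory. A Cauchy sequence of rationals is a function $X:\mathbb N\to\mathbb Q$ such that for every positive rational $\epsilon$ there is $N\in\mathbb N$ with $|X(n)-X(m)|<\epsilon$ for all $m,n>N$. A modulus of convergence for $X$ is a function $f$ from the positive rationals to $\mathbb N$ such that for every positive rational $\epsilon$, $|X(n)-X(m)|<\epsilon$ for all $m,n>f(\epsilon)$. A sequence-modulus pair is a pair $\langle X,f\rangle$ with $X$ a Cauchy sequence of rationals and $f$ a modulus of convergence for $X$. Two pairs $\langle X,f\rangle,\langle Y,g\rangle$ are equivalent if $\forall m\ge1\;\exists N\;\forall k>N\;|X(k)-Y(k)|<1/m$. A (Cauchy) real is an equivalence class of sequence-modulus pairs. For Cauchy sequences $x,y$, $d(x,y)$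 is the sequence $n\mapsto|x(n)-y(n)|$ and $x<y$ means that there are $m,N\in\mathbb N$, $m\ge1$, with $x(k)+1/m<y(k)$ for all $k>N$; rationals are identified with constant sequences; these notions are well defined on reals via representatives. A sequence $\langle x_j\mid j\in\mathbb N\rangle$ of reals is Cauchy if for every positive rational $\epsilon$ there is $N$ with $d(x_j,x_k)<\epsilon$ for all $j,k>N$; a real $y$ is a limit of it if for every positive rational $\epsilon$ there is $N$ with $d(x_j,y)<\epsilon$ for all $j>N$. *)

(* Defs.v *)
From Stdlib Require Import List Arith.
Import ListNotations.

(** Formulas of first-order logic with equality over the signature [{∈}].
    Variables are de Bruijn indices.  The signature has no function symbols,
    so the only terms are variables and substitution is renaming. *)

Inductive form : Type :=
| Bot : form
| Eq  : nat -> nat -> form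
| Mem : nat -> nat -> form
| And : form -> form -> form
| Or  : form -> form -> form
| Imp : form -> form -> form
| All : form -> form
| Ex  : form -> form.

Definition up (r : nat -> nat) (i : nat) : nat :=
  match i with 0 => 0 | S j => S (r j) end.

Fixpoint ren (r : nat -> nat) (p : form) : form :=
  match p with
  | Bot => Bot
  | Eq i j => Eq (r i) (r j)
  | Mem i j => Mem (r i) (r j)
  | And p q => And (ren r p) (ren r q)
  | Or p q => Or (ren r p) (ren r q)
  | Imp p q => Imp (ren r p) (ren r q)
  | All p => All (ren (up r) p)
  | Ex p => Ex (ren (up r) p)
  end.

Definition shift : form -> form := ren S.

(** [inst i p] substitutes [i] for the index 0 of [p], removing a binder. *)
Definition inst (i : nat) : form -> form :=
  ren (fun k => match k with 0 => i | S j => j end).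

Fixpoint bounded (n : nat) (p : form) : Prop :=
  match p with
  | Bot => True
  | Eq i j | Mem i j => i < n /\ j < n
  | And p q | Or p q | Imp p q => bounded n p /\ bounded n q
  | All p | Ex p => bounded (S n) p
  end.

Fixpoint relativize (z : nat) (p : form) : form :=
  match p with
  | Bot => Bot
  | Eq i j => Eq i j
  | Mem i j => Mem i j
  | And p q => And (relativize z p) (relativize z q)
  | Or p q => Or (relativize z p) (relativize z q)
  | Imp p q => Imp (relativize z p) (relativize z q)
  | All p => All (Imp (Mem 0 (S z)) (relativize (S z) p))
  | Ex p => Ex (And (Mem 0 (S z)) (relativize (S z) p))
  end.

Inductive logic : Type := Intuitionistic | Classical.

(** Natural deduction.  The eigenvariable conditions of [d_all_i] and [d_ex_e]
    concern the context [G] only, never the theory [T]; hence an axiom with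
    free variables (the parameters of a schema) has the same force as its
    universal closure. *)
Inductive deriv (L : logic) (T : form -> Prop) : list form -> form -> Prop :=
| d_ax G p : T p -> deriv L T G p
| d_hyp G p : In p G -> deriv L T G p
| d_bot_e G p : deriv L T G Bot -> deriv L T G p
| d_dne G p : L = Classical ->
    deriv L T G (Imp (Imp p Bot) Bot) -> deriv L T G p
| d_and_i G p q : deriv L T G p -> deriv L T G q -> deriv L T G (And p q)
| d_and_e1 G p q : deriv L T G (And p q) -> deriv L T G p
| d_and_e2 G p q : deriv L T G (And p q) -> deriv L T G q
| d_or_i1 G p q : deriv L T G p -> deriv L T G (Or p q)
| d_or_i2 G p q : deriv L T G q -> deriv L T G (Or p q)
| d_or_e G p q r : deriv L T G (Or p q) ->
    deriv L T (p :: G) r -> deriv L T (q :: G) r -> deriv L T G r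
| d_imp_i G p q : deriv L T (p :: G) q -> deriv L T G (Imp p q)
| d_imp_e G p q : deriv L T G (Imp p q) -> deriv L T G p -> deriv L T G q
| d_all_i G p : deriv L T (map shift G) p -> deriv L T G (All p)
| d_all_e G p i : deriv L T G (All p) -> deriv L T G (inst i p)
| d_ex_i G p i : deriv L T G (inst i p) -> deriv L T G (Ex p)
| d_ex_e G p q : deriv L T G (Ex p) ->
    deriv L T (p :: map shift G) (shift q) -> deriv L T G q
| d_eq_refl G i : deriv L T G (Eq i i)
| d_eq_subst G p i j : deriv L T G (Eq i j) ->
    deriv L T G (inst i p) -> deriv L T G (inst j p).

Definition proves (L : logic) (T : form -> Prop) (p : form) : Prop :=
  deriv L T [] p.

Definition consistent (L : logic) (T : form -> Prop) : Prop :=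
  ~ proves L T Bot.

(** A [fml] is a formula as a function of the number of binders above it, a
    [var] a variable as a function of the same number.  The binder entered at
    depth [l] is the index [d - S l] when referred to at depth [d]; this lets
    Rocq's [fun x => ...] bind the object-level variables. *)

Definition var : Type := nat -> nat.
Definition fml : Type := nat -> form.

Definition bound (l : nat) : var := fun d => d - S l.

(** The [i]-th free variable of the whole formula. *)
Definition par (i : nat) : var := fun d => d + i.

Definition fbot : fml := fun _ => Bot.
Definition feq (x y : var) : fml := fun d => Eq (x d) (y d).
Definition fmem (x y : var) : fml := fun d => Mem (x d) (y d).
Definition fand (p q : fml) : fml := fun d => And (p d) (q d).
Definition for_ (p q : fml) : fml := fun d => Or (p d) (q d).
Definition fimp (p q : fml) : fml := fun d => Imp (p d) (q d).
Definition fall (f : var -> fml) : fml := fun d => All (f (bound d) (S d)).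
Definition fex (f : var -> fml) : fml := fun d => Ex (f (bound d) (S d)).

Declare Scope fml_scope.
Delimit Scope fml_scope with fml.
Bind Scope fml_scope with fml.
Local Open Scope fml_scope.

Notation "⊥" := fbot : fml_scope.
Notation "x ≐ y" := (feq x y) (at level 70, no associativity) : fml_scope.
Notation "x ∈ y" := (fmem x y) (at level 70, no associativity) : fml_scope.
Notation "p ⇒ q" := (fimp p q) (at level 90, right associativity) : fml_scope.
Notation "¬ p" := (fimp p fbot) (at level 75, right associativity) : fml_scope.
Notation "p ∧ q" := (fand p q) (at level 80, right associativity) : fml_scope.
Notation "p ∨ q" := (for_ p q) (at level 85, right associativity) : fml_scope.
Notation "p ⇔ q" := (fand (fimp p q) (fimp q p))
  (at level 95, no associativity) : fml_scope.
Notation "∀ x .. y , p" := (fall (fun x => .. (fall (fun y => p)) ..))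
  (at level 200, x binder, y binder, right associativity) : fml_scope.
Notation "∃ x .. y , p" := (fex (fun x => .. (fex (fun y => p)) ..))
  (at level 200, x binder, y binder, right associativity) : fml_scope.

Definition fall_in (A : var -> fml) (f : var -> fml) : fml := ∀ x, A x ⇒ f x.
Definition fex_in (A : var -> fml) (f : var -> fml) : fml := ∃ x, A x ∧ f x.

Notation "∀[ A ] x .. y , p" :=
  (fall_in A (fun x => .. (fall_in A (fun y => p)) ..))
  (at level 200, x binder, y binder, right associativity) : fml_scope.
Notation "∃[ A ] x .. y , p" :=
  (fex_in A (fun x => .. (fex_in A (fun y => p)) ..))
  (at level 200, x binder, y binder, right associativity) : fml_scope.

Definition elt (a : var) : var -> fml := fun x => x ∈ a.

Definition fex_unique (f : var -> fml) : fml :=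
  ∃ y, f y ∧ ∀ y', f y' ⇒ y' ≐ y.

(** [plug p [x0; ...; xk]] is the formula [p] with [x0, ..., xk] for its indices
    [0, ..., k] and with its remaining indices as free variables. *)
Definition plug (p : form) (xs : list var) : fml := fun d =>
  ren (fun i => match nth_error xs i with
                | Some x => x d
                | None => par (i - length xs) d
                end) p.

Definition frel (z : var) (p : fml) : fml := fun d => relativize (z d) (p d).

Fixpoint pars_in (n : nat) (z : var) : fml :=
  match n with
  | 0 => ¬ ⊥
  | S m => pars_in m z ∧ par m ∈ z
  end.

(** The formula of depth 0; its free indices are exactly the [par]s. *)
Definition sentence (p : fml) : form := p 0.

Definition subset (x y : var) : fml := ∀[elt x] z, z ∈ y.
Definition transitive (x : var) : fml := ∀[elt x] y, subset y x.
Definition is_empty (x : var) : fml := ∀ z, ¬ z ∈ x.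
(** [p = {x, y}] *)
Definition is_upair (x y p : var) : fml := ∀ z, z ∈ p ⇔ (z ≐ x ∨ z ≐ y).
(** [p = ⟨x, y⟩ = {{x}, {x, y}}] *)
Definition is_pair (x y p : var) : fml :=
  ∃ a b, is_upair x x a ∧ is_upair x y b ∧ is_upair a b p.
(** [y = x ∪ {x}] *)
Definition is_succ (x y : var) : fml := ∀ z, z ∈ y ⇔ (z ∈ x ∨ z ≐ x).
Definition inductive (w : var) : fml :=
  (∃[elt w] e, is_empty e) ∧ ∀[elt w] x, ∃[elt w] y, is_succ x y.
Definition is_omega (w : var) : fml :=
  inductive w ∧ ∀[inductive] v, subset w v.

(** [f(x) = y]. *)
Definition app (f x y : var) : fml := ∃[elt f] p, is_pair x y p.
Definition is_fun (A B : var -> fml) (f : var) : fml :=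
  (∀[elt f] p, ∃[A] x, ∃[B] y, is_pair x y p) ∧
  ∀[A] x, fex_unique (app f x).

Definition ax_ext : form :=
  sentence (∀ x y, (∀ z, z ∈ x ⇔ z ∈ y) ⇒ x ≐ y).
Definition ax_empty : form := sentence (∃ x, is_empty x).
Definition ax_pairing : form := sentence (∀ x y, ∃ z, is_upair x y z).
Definition ax_union : form :=
  sentence (∀ x, ∃ y, ∀ z, z ∈ y ⇔ ∃[elt x] u, z ∈ u).
Definition ax_infinity : form := sentence (∃ w, inductive w).
Definition ax_power : form := sentence (∀ x, ∃ y, ∀ z, z ∈ y ⇔ subset z x).
Definition ax_foundation : form :=
  sentence (∀ x, (∃ y, y ∈ x) ⇒ ∃[elt x] y, ∀[elt y] z, ¬ z ∈ x).
Definition ax_set_induction (p : form) : form :=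
  sentence ((∀ x, (∀[elt x] y, plug p [y]) ⇒ plug p [x]) ⇒ ∀ x, plug p [x]).
Definition ax_separation (p : form) : form :=
  sentence (∀ a, ∃ b, ∀ x, x ∈ b ⇔ (x ∈ a ∧ plug p [x])).
Definition ax_replacement (p : form) : form :=
  sentence (∀ a, (∀[elt a] x, fex_unique (fun y => plug p [x; y])) ⇒
    ∃ b, ∀ y, y ∈ b ⇔ ∃[elt a] x, plug p [x; y]).
(** [p] has the distinguished variable 0 and the parameters [1, ..., n], which
    become the free variables [par 0, ..., par (n - 1)] of the axiom. *)
Definition ax_reflection (n : nat) (p : form) : form :=
  sentence (∀ z, ∃ Z, transitive Z ∧ z ∈ Z ∧ pars_in n Z ∧
    ∀[elt Z] x, plug p [x] ⇔ frel Z (plug p [x])).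

Inductive ZF : form -> Prop :=
| ZF_ext : ZF ax_ext
| ZF_empty : ZF ax_empty
| ZF_pairing : ZF ax_pairing
| ZF_union : ZF ax_union
| ZF_infinity : ZF ax_infinity
| ZF_power : ZF ax_power
| ZF_foundation : ZF ax_foundation
| ZF_separation p : ZF (ax_separation p)
| ZF_replacement p : ZF (ax_replacement p).

Inductive IZF_Ref : form -> Prop :=
| IZF_ext : IZF_Ref ax_ext
| IZF_empty : IZF_Ref ax_empty
| IZF_pairing : IZF_Ref ax_pairing
| IZF_union : IZF_Ref ax_union
| IZF_infinity : IZF_Ref ax_infinity
| IZF_power : IZF_Ref ax_power
| IZF_set_induction p : IZF_Ref (ax_set_induction p)
| IZF_separation p : IZF_Ref (ax_separation p)
| IZF_reflection n p : bounded (S n) p -> IZF_Ref (ax_reflection n p).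

(** The von Neumann naturals, so that [m < n] is [m ∈ n]. *)

Definition is_nat (n : var) : fml := ∃[is_omega] w, n ∈ w.
Definition is_one (n : var) : fml := ∃[is_empty] z, is_succ z n.
Definition is_posnat (n : var) : fml := is_nat n ∧ ∃[is_empty] z, z ∈ n.

(** [k] is the value at [n] of the function on naturals defined by recursion
    from the value [a] at 0 and the step relation [step]. *)
Definition iterate (a : var) (step : var -> var -> fml) (n k : var) : fml :=
  ∃[is_fun is_nat is_nat] f,
    (∃[is_empty] z, app f z a) ∧
    (∀[is_nat] i i' v v',
       is_succ i i' ⇒ app f i v ⇒ app f i' v' ⇒ step v v') ∧
    app f n k.

(** [m + n = k] *)
Definition nat_add (m n k : var) : fml := iterate m is_succ n k.
(** [m * n = k] *)
Definition nat_mul (m n k : var) : fml :=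
  ∃[is_empty] z, iterate z (fun v v' => nat_add v m v') n k.
(** [a * b + c * d = k] *)
Definition nat_mul_add (a b c d k : var) : fml :=
  ∃ u v, nat_mul a b u ∧ nat_mul c d v ∧ nat_add u v k.

(** A triple [⟨⟨a, b⟩, c⟩] of naturals with [c <> 0] stands for [(a - b) / c];
    a rational is an equivalence class of such triples. *)

Definition is_frac (a b c t : var) : fml :=
  is_nat a ∧ is_nat b ∧ is_posnat c ∧ ∃ u, is_pair a b u ∧ is_pair u c t.
(** [(a - b) / c = (a' - b') / c'] *)
Definition frac_eq (a b c a' b' c' : var) : fml :=
  ∃ s, nat_mul_add a c' b' c s ∧ nat_mul_add a' c b c' s.
(** [(a - b) / c < (a' - b') / c'] *)
Definition frac_lt (a b c a' b' c' : var) : fml :=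
  ∃ s t, nat_mul_add a c' b' c s ∧ nat_mul_add a' c b c' t ∧ s ∈ t.

Definition rat_of (a b c q : var) : fml :=
  is_nat a ∧ is_nat b ∧ is_posnat c ∧
  ∀ t, t ∈ q ⇔ ∃ a' b' c', is_frac a' b' c' t ∧ frac_eq a b c a' b' c'.
Definition is_rat (q : var) : fml := ∃ a b c, rat_of a b c q.

Definition rat_lt (p q : var) : fml :=
  ∃ a b c a' b' c',
    rat_of a b c p ∧ rat_of a' b' c' q ∧ frac_lt a b c a' b' c'.
Definition rat_le (p q : var) : fml := rat_lt p q ∨ (is_rat p ∧ p ≐ q).
(** [p + q = r] *)
Definition rat_add (p q r : var) : fml :=
  ∃ a b c a' b' c', rat_of a b c p ∧ rat_of a' b' c' q ∧
  ∃ s t u, nat_mul_add a c' a' c s ∧ nat_mul_add b c' b' c t ∧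
           nat_mul c c' u ∧ rat_of s t u r.
(** [|p - q| = r] *)
Definition rat_dist (p q r : var) : fml :=
  (rat_le p q ∧ rat_add p r q) ∨ (rat_le q p ∧ rat_add q r p).
(** [1 / m = r] *)
Definition rat_recip (m r : var) : fml :=
  ∃[is_empty] z, ∃[is_one] o, rat_of o z m r.
Definition is_rat_zero (r : var) : fml :=
  ∃[is_empty] z, ∃[is_one] o, rat_of z z o r.
Definition is_posrat (e : var) : fml := ∃[is_rat_zero] z, rat_lt z e.

Definition is_ratseq (X : var) : fml := is_fun is_nat is_rat X.

(** [|X(n) - Y(m)| < e] *)
Definition near (X n Y m e : var) : fml :=
  ∃ p q r, app X n p ∧ app Y m q ∧ rat_dist p q r ∧ rat_lt r e.

Definition is_cauchy (X : var) : fml :=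
  is_ratseq X ∧
  ∀[is_posrat] e, ∃[is_nat] N, ∀[is_nat] m n,
    N ∈ m ⇒ N ∈ n ⇒ near X n X m e.

Definition is_modulus (X f : var) : fml :=
  is_fun is_posrat is_nat f ∧
  ∀[is_posrat] e, ∀ N, app f e N ⇒ ∀[is_nat] m n,
    N ∈ m ⇒ N ∈ n ⇒ near X n X m e.

(** [s = ⟨X, f⟩] is a sequence-modulus pair. *)
Definition is_seqmod_of (X f s : var) : fml :=
  is_pair X f s ∧ is_cauchy X ∧ is_modulus X f.
Definition is_seqmod (s : var) : fml := ∃ X f, is_seqmod_of X f s.

Definition seqmod_equiv (s t : var) : fml :=
  ∃ X f Y g, is_seqmod_of X f s ∧ is_seqmod_of Y g t ∧
  ∀[is_posnat] m, ∃[is_nat] N, ∀[is_nat] k, N ∈ k ⇒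
    ∃ r, rat_recip m r ∧ near X k Y k r.

Definition seq_lt (X Y : var) : fml :=
  ∃[is_posnat] m, ∃[is_nat] N, ∀[is_nat] k, N ∈ k ⇒
    ∃ p q r s, app X k p ∧ app Y k q ∧
               rat_recip m r ∧ rat_add p r s ∧ rat_lt s q.
(** [D = d(X, Y)] *)
Definition is_dist_seq (X Y D : var) : fml :=
  is_ratseq D ∧
  ∀[is_nat] n, ∃ p q r, app X n p ∧ app Y n q ∧ app D n r ∧ rat_dist p q r.
Definition is_const_seq (q C : var) : fml :=
  is_ratseq C ∧ ∀[is_nat] n, app C n q.

Definition is_real (x : var) : fml :=
  ∃[is_seqmod] s, ∀ t, t ∈ x ⇔ (is_seqmod t ∧ seqmod_equiv s t).

(** [d(x, y) < e] for reals [x], [y] and a rational [e] *)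
Definition real_dist_lt (x y e : var) : fml :=
  ∃[elt x] s, ∃[elt y] t, ∃ X f Y g D C,
    is_seqmod_of X f s ∧ is_seqmod_of Y g t ∧
    is_dist_seq X Y D ∧ is_const_seq e C ∧ seq_lt D C.

Definition is_realseq (h : var) : fml := is_fun is_nat is_real h.

Definition is_cauchy_realseq (h : var) : fml :=
  is_realseq h ∧
  ∀[is_posrat] e, ∃[is_nat] N, ∀[is_nat] j k, N ∈ j ⇒ N ∈ k ⇒
    ∃ x y, app h j x ∧ app h k y ∧ real_dist_lt x y e.

Definition is_limit (h y : var) : fml :=
  is_real y ∧
  ∀[is_posrat] e, ∃[is_nat] N, ∀[is_nat] j, N ∈ j ⇒
    ∃ x, app h j x ∧ real_dist_lt x y e.

Definition cauchy_completeness : form :=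
  sentence (∀[is_cauchy_realseq] h, ∃ y, is_limit h y).

(* Main.v *)
From Stdlib Require Import List Arith Lia Reals Lra Classical ClassicalEpsilon.
Require Import Defs.
Import ListNotations.

(** The independence is witnessed by a topological model built inside the
    metatheory, whose universes and choice principle play the part of a strong
    set theory.  Its sets are names: small families of names whose members are
    each present on an open set of points.  Truth is defined point by point,
    conjunction, disjunction and existence being local at the point, while
    implication and universal quantification speak of a neighbourhood.
    Intuitionistic deduction preserves truth ([soundness]) and the axioms hold
    ([force_IZF_Ref]); for Reflection, a set of names is closed under members
    and under witnesses and counterexamples for all formulas, as in the downward
    Loewenheim-Skolem theorem.

    Naturals and rationals of the model are constant, so a sequence of rationals
    with a modulus is a family of sequences that depends on the point, each term
    and each value of the modulus being locally constant.  A Cauchy real is thus,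
    near a point, a function [F] on points that is the limit, at a prescribed
    rate, of locally constant rational functions: [F] is liftable
    ([liftable_repr], [repr_liftable]).  Being liftable is a local condition, but
    the neighbourhood on which the lift exists may shrink along a sequence of
    functions.  If functions [G j] liftable at every point converge uniformly to
    [F], they form in the model a Cauchy sequence of reals whose limit can only
    be [F].  So a proof of completeness would make [F] liftable everywhere
    ([completeness_lifts]).

    The space that refutes this has levels [0, 1, 2, ...] and one more point, the
    apex, whose neighbourhoods contain all levels from some point on.  A level
    consists of two copies of the line: isolated points, and cluster points whose
    neighbourhoods contain the isolated points of nearby coordinate.  A function
    on a level that is Lipschitz in the coordinate is liftable: at a cluster
    point, the [m]-th approximation is constant on a small ball and follows the
    function at the isolated points outside it.  But the neighbourhoods of the
    cluster points cover a level, so a function that is locally constant on a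
    whole level is locally constant, hence constant, on its line of isolated
    points.  A function that varies on every level, by at most [1 / (k + 1)] on
    level [k], is therefore not liftable at the apex ([height_not_liftable]),
    although it is the uniform limit of its truncations to finitely many levels,
    which are liftable everywhere ([truncated_lifts]). *)

(** * Neighbourhood spaces and names *)

Section Forcing.

Variable pt : Set.
(** The sets [N x n] for [n] in [nat] are a decreasing base of open
    neighbourhoods of [x]. *)
Variable N : pt -> nat -> pt -> Prop.
Hypothesis N_refl : forall x n, N x n x.
Hypothesis N_anti : forall x n m y, n <= m -> N x m y -> N x n y.
Hypothesis N_open : forall x n y, N x n y ->
  exists m, forall z, N y m z -> N x n z.

(** [box P] is the interior of [P]. *)
Definition box (P : pt -> Prop) (x : pt) : Prop :=
  exists n, forall y, N x n y -> P y.

Lemma box_elim P x : box P x -> P x.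
Proof. intros [n H]. apply H, N_refl. Qed.

Lemma box_box P x : box P x -> box (box P) x.
Proof.
  intros [n H]. exists n. intros y Hy.
  destruct (N_open _ _ _ Hy) as [m Hm]. exists m. auto.
Qed.

Lemma box_mono (P Q : pt -> Prop) x : (forall y, P y -> Q y) -> box P x -> box Q x.
Proof. intros H [n Hn]. exists n. auto. Qed.

Lemma box_and P Q x : box P x -> box Q x -> box (fun y => P y /\ Q y) x.
Proof.
  intros [n Hn] [m Hm]. exists (max n m). intros y Hy. split.
  - apply Hn. revert Hy. apply N_anti. lia.
  - apply Hm. revert Hy. apply N_anti. lia.
Qed.

Lemma box_all (P : pt -> Prop) x : (forall y, P y) -> box P x.
Proof. exists 0. auto. Qed.

(** The way to work with a neighbourhood: facts stable under [box] are kept as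
    boxed hypotheses, and so survive each passage to a nearby point. *)
Lemma box1 (P Q : pt -> Prop) x :
  box P x -> (forall y, box P y -> Q y) -> box Q x.
Proof. intros H K. apply box_box in H. revert H. apply box_mono. auto. Qed.

Lemma box2 (P P' Q : pt -> Prop) x :
  box P x -> box P' x -> (forall y, box P y -> box P' y -> Q y) -> box Q x.
Proof.
  intros H H' K. apply (box1 _ _ _ (box_and _ _ _ H H')).
  intros y Hy. apply K; revert Hy; apply box_mono; tauto.
Qed.

Lemma box3 (P P' P'' Q : pt -> Prop) x :
  box P x -> box P' x -> box P'' x ->
  (forall y, box P y -> box P' y -> box P'' y -> Q y) -> box Q x.
Proof.
  intros H H' H'' K. apply (box2 _ _ _ _ (box_and _ _ _ H H') H'').
  intros y Hy Hy''. apply K; auto; revert Hy; apply box_mono; tauto.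
Qed.

Lemma box_list {A} (l : list A) (P : A -> pt -> Prop) x :
  (forall a, In a l -> box (P a) x) -> box (fun y => forall a, In a l -> P a y) x.
Proof.
  induction l as [|b l IH]; intros H.
  - apply box_all. simpl. tauto.
  - apply (box2 _ _ _ _ (H b (or_introl eq_refl)) (IH (fun a h => H a (or_intror h)))).
    intros y Hb Hl a [<-|Ha]; [exact (box_elim _ _ Hb)|exact (box_elim _ _ Hl a Ha)].
Qed.

(** A name: its member [f i] is present on the interior of [E i]. *)
Inductive V : Type := mk (A : Type) (f : A -> V) (E : A -> pt -> Prop).

(** Extensional equality of names, true where it holds on a neighbourhood. *)
Fixpoint eqV (a b : V) {struct a} : pt -> Prop :=
  match a, b with mk A f E, mk B g G =>
    box (fun y =>
      (forall i, box (E i) y -> exists j, box (G j) y /\ eqV (f i) (g j) y) /\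
      (forall j, box (G j) y -> exists i, box (E i) y /\ eqV (f i) (g j) y))
  end.

Lemma eqV_mk A f E B g G : eqV (mk A f E) (mk B g G) = box (fun y =>
  (forall i, box (E i) y -> exists j, box (G j) y /\ eqV (f i) (g j) y) /\
  (forall j, box (G j) y -> exists i, box (E i) y /\ eqV (f i) (g j) y)).
Proof. reflexivity. Qed.

Definition memV (a b : V) (x : pt) : Prop :=
  match b with mk B g G => exists j, box (G j) x /\ eqV a (g j) x end.

Lemma eqV_box a b x : eqV a b x -> box (eqV a b) x.
Proof. destruct a, b. apply box_box. Qed.

Lemma eqV_refl a : forall x, eqV a a x.
Proof.
  induction a as [A f IH E]. intros x. rewrite eqV_mk. apply box_all. intros y.
  split; intros i Hi; exists i; split; try exact Hi; apply IH.
Qed.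

Lemma eqV_sym a : forall b x, eqV a b x -> eqV b a x.
Proof.
  induction a as [A f IH E]. intros [B g G] x. rewrite !eqV_mk. apply box_mono. intros y [H1 H2].
  split; intros i Hi.
  - destruct (H2 i Hi) as (j & Hj & Hij). exists j. auto.
  - destruct (H1 i Hi) as (j & Hj & Hij). exists j. auto.
Qed.

Lemma eqV_trans a : forall b c x, eqV a b x -> eqV b c x -> eqV a c x.
Proof.
  induction a as [A f IH E]. intros [B g G] [C h K] x. rewrite !eqV_mk. intros H1 H2.
  apply (box2 _ _ _ _ H1 H2). intros y H1' H2'.
  apply box_elim in H1', H2'. destruct H1' as [H1a H1b], H2' as [H2a H2b].
  split; intros i Hi.
  - destruct (H1a i Hi) as (j & Hj & Hij), (H2a j Hj) as (k & Hk & Hjk).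
    exists k. eauto.
  - destruct (H2b i Hi) as (j & Hj & Hij), (H1b j Hj) as (k & Hk & Hjk).
    exists k. eauto.
Qed.

Lemma memV_box a b x : memV a b x -> box (memV a b) x.
Proof.
  destruct b as [B g G]. intros (j & Hj & E).
  apply (box2 _ _ _ _ Hj (eqV_box _ _ _ E)). intros y H1 H2.
  exists j. split; [exact H1|exact (box_elim _ _ H2)].
Qed.

Lemma memV_l a a' b x : eqV a a' x -> memV a b x -> memV a' b x.
Proof.
  destruct b as [B g G]. intros E (j & Hj & E'). exists j. split; auto.
  eapply eqV_trans; [apply eqV_sym|]; eauto.
Qed.

Lemma memV_r a b b' x : eqV b b' x -> memV a b x -> memV a b' x.
Proof.
  destruct b as [B g G], b' as [B' g' G']. rewrite eqV_mk. intros E (j & Hj & E').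
  apply box_elim in E. destruct E as [E _]. destruct (E j Hj) as (k & Hk & E'').
  exists k. split; auto. eapply eqV_trans; eauto.
Qed.

Lemma memV_idx A f E (i : A) x : box (E i) x -> memV (f i) (mk A f E) x.
Proof. intros H. exists i. split; auto using eqV_refl. Qed.

Definition carrier (v : V) : Type := match v with mk A _ _ => A end.
Definition child (v : V) : carrier v -> V := match v with mk _ f _ => f end.
Definition extent (v : V) : carrier v -> pt -> Prop :=
  match v with mk _ _ E => E end.

Lemma memV_child a v x :
  memV a v x <-> exists i : carrier v, box (extent v i) x /\ eqV a (child v i) x.
Proof. destruct v. reflexivity. Qed.

Lemma eqV_intro a b x :
  box (fun y => forall z, memV z a y <-> memV z b y) x -> eqV a b x.
Proof.
  destruct a as [A f E], b as [B g G]. intros H. rewrite eqV_mk. apply (box1 _ _ _ H).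
  intros y Hy. apply box_elim in Hy. split; intros i Hi.
  - apply (Hy (f i)), memV_idx, Hi.
  - destruct (proj2 (Hy (g i)) (memV_idx _ g G _ _ Hi)) as (j & Hj & Hij).
    exists j. auto using eqV_sym.
Qed.

(** * Truth at a point and soundness of deduction *)

Definition scons {A} (a : A) (e : nat -> A) (i : nat) : A :=
  match i with 0 => a | S j => e j end.

(** Kripke-Joyal semantics read at a point: unions of open sets are computed
    pointwise, which makes disjunction and existence those of the metatheory,
    whereas the other connectives need an interior. *)
Fixpoint force (p : form) (e : nat -> V) (x : pt) {struct p} : Prop :=
  match p with
  | Bot => False
  | Eq i j => eqV (e i) (e j) x
  | Mem i j => memV (e i) (e j) x
  | And p q => force p e x /\ force q e x
  | Or p q => force p e x \/ force q e x
  | Imp p q => box (fun y => force p e y -> force q e y) x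
  | All p => box (fun y => forall a, force p (scons a e) y) x
  | Ex p => exists a, force p (scons a e) x
  end.

Lemma force_box p : forall e x, force p e x -> box (force p e) x.
Proof.
  induction p; simpl; intros e x H; auto using eqV_box, memV_box, box_box.
  - destruct H.
  - destruct H. apply box_and; auto.
  - destruct H as [H|H]; [apply IHp1 in H|apply IHp2 in H];
      revert H; apply box_mono; auto.
  - destruct H as [a H]. apply IHp in H. revert H. apply box_mono. eauto.
Qed.

(** For [force_ext] all the equations between two environments have to hold on
    one common neighbourhood, as infinitely many neighbourhoods may have no
    common one. *)
Definition eqenv (e e' : nat -> V) (y : pt) : Prop := forall i, eqV (e i) (e' i) y.

Lemma eqenv_sym e e' x : box (eqenv e e') x -> box (eqenv e' e) x.
Proof. apply box_mono. intros y H i. apply eqV_sym, H. Qed.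

Lemma eqenv_scons a e e' x : box (eqenv e e') x ->
  box (eqenv (scons a e) (scons a e')) x.
Proof. apply box_mono. intros y H [|i]; [apply eqV_refl|apply H]. Qed.

Lemma force_ext p : forall e e' x, box (eqenv e e') x ->
  force p e x -> force p e' x.
Proof.
  induction p; simpl; intros e e' x He H.
  - auto.
  - apply box_elim in He. apply (eqV_trans _ (e n)), (eqV_trans _ (e n0));
      auto using eqV_sym.
  - apply box_elim in He. eapply memV_l; [apply He|]. eapply memV_r; [apply He|]. auto.
  - destruct H; split; eauto.
  - destruct H; [left|right]; eauto.
  - apply (box2 _ _ _ _ He H). intros y He' H' Hp. apply (IHp2 e); auto.
    apply box_elim in H'. apply H', (IHp1 e'); auto using eqenv_sym.
  - apply (box2 _ _ _ _ He H). intros y He' H' a.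
    apply (IHp (scons a e)); auto using eqenv_scons. apply box_elim in H'. auto.
  - destruct H as [a H]. exists a. apply (IHp (scons a e)); auto using eqenv_scons.
Qed.

Lemma force_env p e e' x : (forall i, e i = e' i) -> force p e x <-> force p e' x.
Proof.
  intros H; split; apply force_ext, box_all; intros y i; rewrite H; apply eqV_refl.
Qed.

Lemma box_iff (P Q : pt -> Prop) x :
  (forall y, P y <-> Q y) -> box P x <-> box Q x.
Proof. intros H; split; apply box_mono; apply H. Qed.

Lemma force_ren p : forall r e x,
  force (ren r p) e x <-> force p (fun i => e (r i)) x.
Proof.
  induction p; simpl; intros r e x; try tauto.
  - rewrite IHp1, IHp2. tauto.
  - rewrite IHp1, IHp2. tauto.
  - apply box_iff. intros y. rewrite IHp1, IHp2. tauto.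
  - apply box_iff. intros y. split; intros H a; specialize (H a).
    + apply IHp in H. revert H. apply force_env. now intros [|i].
    + apply IHp. revert H. apply force_env. now intros [|i].
  - split; intros [a H]; exists a.
    + apply IHp in H. revert H. apply force_env. now intros [|i].
    + apply IHp. revert H. apply force_env. now intros [|i].
Qed.

Lemma force_shift p a e x : force (shift p) (scons a e) x <-> force p e x.
Proof. unfold shift. rewrite force_ren. now apply force_env. Qed.

Lemma force_inst p i e x : force (inst i p) e x <-> force p (scons (e i) e) x.
Proof. unfold inst. rewrite force_ren. apply force_env. now intros [|j]. Qed.

Lemma force_eq_inst p i j e x :
  eqV (e i) (e j) x -> force (inst i p) e x -> force (inst j p) e x.
Proof.
  intros E. rewrite !force_inst. apply force_ext.
  apply eqV_box in E. revert E. apply box_mono. intros y E [|k]; auto using eqV_refl.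
Qed.

(** Both introduction rules that enlarge a context or its variables move to a
    nearby point; the finitely many hypotheses remain true there since truth is
    open. *)
Theorem soundness T G p :
  (forall q, T q -> forall e x, force q e x) ->
  deriv Intuitionistic T G p ->
  forall e x, (forall q, In q G -> force q e x) -> force p e x.
Proof.
  intros HT D.
  assert (HG : forall (G : list form) e x, (forall q, In q G -> force q e x) ->
    box (fun y => forall q, In q G -> force q e y) x).
  { intros G' e x HG. apply box_list. intros q Hq. auto using force_box. }
  assert (HS : forall (G : list form) e a x, (forall q, In q G -> force q e x) ->
    forall q, In q (map shift G) -> force q (scons a e) x).
  { intros G' e a x H q Hq. apply in_map_iff in Hq as (q' & <- & Hq).
    apply force_shift. auto. }
  induction D; intros e x HGx; simpl in *; auto.
  - exfalso. eauto.
  - discriminate.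
  - apply (IHD e x HGx).
  - apply (IHD e x HGx).
  - destruct (IHD1 e x HGx); [apply IHD2|apply IHD3]; intros ? [<-|?]; auto.
  - apply (box1 _ _ _ (HG _ _ _ HGx)). intros y Hy Hp. apply box_elim in Hy.
    apply IHD. intros ? [<-|?]; auto.
  - exact (box_elim _ _ (IHD1 e x HGx) (IHD2 e x HGx)).
  - apply (box1 _ _ _ (HG _ _ _ HGx)). intros y Hy a. apply box_elim in Hy.
    apply IHD. exact (HS _ _ _ _ Hy).
  - apply force_inst. exact (box_elim _ _ (IHD e x HGx) _).
  - exists (e i). apply force_inst. auto.
  - destruct (IHD1 e x HGx) as [a Ha]. apply (force_shift q a), IHD2.
    intros ? [<-|?]; auto. now apply (HS G e a x HGx).
  - apply eqV_refl.
  - eapply force_eq_inst; [apply IHD1|apply IHD2]; auto.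
Qed.

(** * The axioms other than Reflection *)

Definition emptyV : V := mk False (fun f => match f with end) (fun _ _ => True).
Definition upairV (a b : V) : V :=
  mk bool (fun i => if i then a else b) (fun _ _ => True).
Definition succV (a : V) : V :=
  match a with mk A f E =>
    mk (option A) (fun i => match i with Some i => f i | None => a end)
       (fun i => match i with Some i => E i | None => fun _ => True end)
  end.
Fixpoint hat (n : nat) : V := match n with 0 => emptyV | S m => succV (hat m) end.
Definition omegaV : V := mk nat hat (fun _ _ => True).

Lemma mem_emptyV z x : ~ memV z emptyV x.
Proof. intros [[] _]. Qed.

Lemma mem_upairV a b z x : memV z (upairV a b) x <-> eqV z a x \/ eqV z b x.
Proof.
  split.
  - intros ([|] & _ & E); auto.
  - intros [E|E]; [exists true|exists false]; split; auto; now apply box_all.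
Qed.

Lemma mem_succV a z x : memV z (succV a) x <-> memV z a x \/ eqV z a x.
Proof.
  destruct a as [A f E]. split.
  - intros ([i|] & Hi & H); [left; exists i|]; auto.
  - intros [(i & Hi & H)|H]; [exists (Some i)|exists None]; split; auto.
    now apply box_all.
Qed.

Lemma mem_omegaV z x : memV z omegaV x <-> exists n, eqV z (hat n) x.
Proof.
  split.
  - intros (n & _ & E). eauto.
  - intros (n & E). exists n. split; auto. now apply box_all.
Qed.

Lemma force_plug p xs d e y :
  force (plug p xs d) e y <->
  force p (fun i => match nth_error xs i with
                    | Some v => e (v d) | None => e (d + (i - length xs)) end) y.
Proof.
  unfold plug. rewrite force_ren. apply force_env. intros i.
  destruct (nth_error xs i); reflexivity.
Qed.

Lemma force_plug1 p v d e y :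
  force (plug p [v] d) e y <->
  force p (scons (e (v d)) (fun i => e (d + i))) y.
Proof.
  rewrite force_plug. apply force_env. intros [|i]; simpl; auto.
  destruct i; simpl; auto.
Qed.

Lemma force_ax_ext e x : force ax_ext e x.
Proof.
  simpl. apply box_all. intros x1 a. apply box_all. intros x2 b.
  apply box_all. intros y H. apply eqV_intro. apply (box1 _ _ _ H).
  intros z Hz c. apply box_elim in Hz. destruct (Hz c) as [H1 H2].
  apply box_elim in H1, H2. split; auto.
Qed.

Lemma force_ax_empty e x : force ax_empty e x.
Proof.
  exists emptyV. apply box_all. intros y a. apply box_all. intros z.
  apply mem_emptyV.
Qed.

Lemma force_ax_pairing e x : force ax_pairing e x.
Proof.
  simpl. apply box_all. intros x1 a. apply box_all. intros x2 b. exists (upairV a b).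
  apply box_all. intros y z.
  split; apply box_all; intros y'; apply mem_upairV.
Qed.

Definition unionV (a : V) : V :=
  match a with mk A f E =>
    mk {i : A & carrier (f i)}
      (fun p => child (f (projT1 p)) (projT2 p))
      (fun p y => box (E (projT1 p)) y /\ box (extent (f (projT1 p)) (projT2 p)) y)
  end.

Lemma mem_unionV a z x : memV z (unionV a) x <-> exists u, memV u a x /\ memV z u x.
Proof.
  destruct a as [A f E]. split.
  - intros ([i b] & H & Hz). apply box_elim in H. destruct H as [H1 H2].
    exists (f i). split; [now apply memV_idx|]. apply memV_child. now exists b.
  - intros (u & (i & Hi & Eu) & Hz). apply (memV_r _ _ _ _ Eu), memV_child in Hz.
    destruct Hz as (b & Hb & Hz). exists (existT _ i b). split; auto.
    apply box_and; now apply box_box.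
Qed.

Lemma force_ax_union e x : force ax_union e x.
Proof.
  simpl. apply box_all. intros x1 a. exists (unionV a).
  apply box_all. intros y z.
  split; apply box_all; intros y'; apply mem_unionV.
Qed.

Lemma force_ax_infinity e x : force ax_infinity e x.
Proof.
  exists omegaV. simpl. split.
  - exists (hat 0). split.
    + apply mem_omegaV. exists 0. apply eqV_refl.
    + apply box_all. intros y z. apply box_all. intros y'. apply mem_emptyV.
  - apply box_all. intros y a. apply box_all. intros y' H.
    apply mem_omegaV in H as [n H]. exists (succV a). split.
    + apply mem_omegaV. exists (S n). apply eqV_intro.
      apply eqV_box in H. revert H. apply box_mono. intros u H v.
      simpl. rewrite !mem_succV. split; (intros [K|K]; [left|right]).
      * eapply memV_r; eauto.
      * eapply eqV_trans; eauto.
      * eapply memV_r; [apply eqV_sym|]; eauto.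
      * eapply eqV_trans; [|apply eqV_sym]; eauto.
    + apply box_all. intros u v. split; apply box_all; intros u'; apply mem_succV.
Qed.

(** Full Separation is immediate: the truth value of an arbitrary formula serves
    as the extent of a member. *)
Definition sepV (a : V) (P : V -> pt -> Prop) : V :=
  match a with mk A f E => mk A f (fun i y => box (E i) y /\ P (f i) y) end.

Definition openP (P : V -> pt -> Prop) : Prop :=
  (forall a x, P a x -> box (P a) x) /\
  (forall a b x, eqV a b x -> P a x -> P b x).

Lemma mem_sepV a P z x : openP P ->
  memV z (sepV a P) x <-> memV z a x /\ P z x.
Proof.
  intros [HP1 HP2]. destruct a as [A f E]. split.
  - intros (i & Hi & H). apply box_elim in Hi. destruct Hi as [H1 H2]. split.
    + exists i. auto.
    + eapply HP2; [apply eqV_sym|]; eauto.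
  - intros [(i & Hi & H) Hz]. exists i. split; auto. apply box_and.
    + now apply box_box.
    + eauto.
Qed.

Lemma openP_force p e : openP (fun a => force p (scons a e)).
Proof.
  split.
  - intros. now apply force_box.
  - intros a b x E. apply force_ext. apply eqV_box in E. revert E.
    apply box_mono. intros y E [|i]; auto using eqV_refl.
Qed.

Definition powV (a : V) : V :=
  match a with mk A f E =>
    mk (A -> pt -> Prop) (fun F => mk A f F)
       (fun F y => box (fun z => forall c, memV c (mk A f F) z -> memV c a z) y)
  end.

(** A subset [z] of [a] agrees with the name that gives each [f i] the truth
    value of its membership in [z]. *)
Lemma subset_name A f E z x :
  box (fun y => forall c, memV c z y -> memV c (mk A f E) y) x ->
  eqV z (mk A f (fun i => memV (f i) z)) x.
Proof.
  intros H. apply eqV_intro. apply (box1 _ _ _ H). intros y Hy c.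
  apply box_elim in Hy. split.
  - intros Hc. destruct (Hy c Hc) as (i & Hi & Ei). exists i. split; auto.
    apply memV_box. eapply memV_l; eauto.
  - intros (i & Hi & Ei). apply box_elim in Hi. eapply memV_l; [apply eqV_sym|]; eauto.
Qed.

(** The names with the same members as [a] and arbitrary extents represent all
    subsets of [a], by [subset_name]; they form a small family. *)
Lemma mem_powV a z x :
  memV z (powV a) x <-> box (fun y => forall c, memV c z y -> memV c a y) x.
Proof.
  destruct a as [A f E]. split.
  - intros (F & HF & EF). apply box_elim in HF.
    apply (box2 _ _ _ _ HF (eqV_box _ _ _ EF)). intros y H1 H2 c Hc.
    apply box_elim in H1, H2. apply H1. eapply memV_r; eauto.
  - intros H. exists (fun i => memV (f i) z).
    pose proof (subset_name _ _ _ _ _ H) as EF. split; auto.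
    apply box_box. apply (box2 _ _ _ _ H (eqV_box _ _ _ EF)).
    intros y H1 H2 c Hc. apply box_elim in H1, H2. apply H1.
    eapply memV_r; [apply eqV_sym|]; eauto.
Qed.

Lemma force_ax_power e x : force ax_power e x.
Proof.
  simpl. apply box_all. intros x1 a. exists (powV a). apply box_all. intros y z.
  split; apply box_all; intros y'; rewrite mem_powV.
  - intros H. apply (box1 _ _ _ H). intros u Hu c. revert Hu. apply box_mono.
    intros u' Hu'. exact (Hu' c).
  - apply box_mono. intros u H c. apply (box_elim _ _ (H c)).
Qed.

Lemma force_ax_separation p e x : force (ax_separation p) e x.
Proof.
  unfold ax_separation, sentence. cbn -[plug]. apply box_all. intros x1 a.
  exists (sepV a (fun z => force p (scons z e))). apply box_all. intros y z.
  split; apply box_all; intros y';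
    rewrite !force_plug1; cbn; rewrite mem_sepV by apply openP_force; auto.
Qed.

Lemma force_ax_set_induction p e x : force (ax_set_induction p) e x.
Proof.
  unfold ax_set_induction, sentence. cbn -[plug]. apply box_all. intros x1 H.
  apply (box1 _ _ _ H). clear x1 H. intros x1 H a. revert x1 H.
  induction a as [A f IH E]. intros x1 H. rewrite force_plug1. cbn.
  pose proof (box_elim _ _ H (mk A f E)) as H'. apply box_elim in H'.
  rewrite force_plug1 in H'. apply H'. clear H'.
  apply (box1 _ _ _ H). intros y Hy b.
  apply (box1 _ _ _ Hy). intros y' Hy' (i & Hi & Hb). apply force_plug1. cbn.
  specialize (IH i _ Hy'). rewrite force_plug1 in IH. cbn in IH.
  revert IH. apply (proj2 (openP_force p e)). now apply eqV_sym.
Qed.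

(** * Reflection *)

Definition family : Type := {J : Type & J -> V}.
Definition listenv (d : V) (l : list V) (i : nat) : V := nth i l d.

(** A witness for the existential statement [Ex p] true at [x], or a
    counterexample to [All p] at [x]. *)
Definition witness (d : V) (t : pt * form * bool) (l : list V) : V :=
  let '(x, p, b) := t in
  epsilon (inhabits d) (fun a =>
    if b then force p (listenv d (a :: l)) x else ~ force p (listenv d (a :: l)) x).

(** One closure step.  A family is small, so the members of its names and the
    witnesses for all points, formulas and finite environments from it are
    indexed by a small type again. *)
Definition enlarge (d : V) (F : family) : family :=
  let (J, g) := F in
  @existT Type (fun J => J -> V) (J + {j : J & carrier (g j)} + (pt * form * bool) * list J)%type
    (fun s => match s with
              | inl (inl j) => g j
              | inl (inr (existT _ j i)) => child (g j) i
              | inr (t, l) => witness d t (map g l)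
              end).

Fixpoint stage (d : V) (e : nat -> V) (n : nat) : family :=
  match n with
  | 0 => @existT Type (fun J => J -> V) nat (scons d e)
  | S m => enlarge d (stage d e m)
  end.

Definition in_family (F : family) (v : V) : Prop := exists j, v = projT2 F j.
Definition in_hull (d : V) (e : nat -> V) (v : V) : Prop :=
  exists n, in_family (stage d e n) v.
(** All members are present everywhere, so quantifiers bounded by [hullV d e]
    range over the names of the hull. *)
Definition hullV (d : V) (e : nat -> V) : V :=
  mk {n : nat & projT1 (stage d e n)} (fun s => projT2 (stage d e (projT1 s)) (projT2 s))
     (fun _ _ => True).

Lemma mem_hullV d e v x :
  memV v (hullV d e) x <-> exists w, in_hull d e w /\ eqV v w x.
Proof.
  split.
  - intros ([n j] & _ & E). eexists. split; [|exact E]. exists n, j. reflexivity.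
  - intros (w & (n & j & ->) & E). exists (existT _ n j). split; auto. now apply box_all.
Qed.

Lemma in_family_enlarge d F v : in_family F v -> in_family (enlarge d F) v.
Proof. destruct F as [J g]. intros [j ->]. now exists (inl (inl j)). Qed.

Lemma in_family_stage d e n m v :
  n <= m -> in_family (stage d e n) v -> in_family (stage d e m) v.
Proof. induction 1; simpl; auto using in_family_enlarge. Qed.

Lemma hull_child d e v i : in_hull d e v -> in_hull d e (child v i).
Proof.
  intros (n & j & ->). exists (S n). simpl.
  destruct (stage d e n) as [J g]. simpl in *. now exists (inl (inr (existT _ j i))).
Qed.

(** The stages increase, so finitely many names of the hull lie in one stage. *)
Lemma hull_list d e l : Forall (in_hull d e) l ->
  exists n l', l = map (projT2 (stage d e n)) l'.
Proof.
  intros H. assert (K : exists n, Forall (in_family (stage d e n)) l).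
  { induction H as [|v l [n Hn] _ [m Hm]]; [exists 0; constructor|].
    exists (max n m). constructor.
    - revert Hn. apply in_family_stage. lia.
    - revert Hm. apply Forall_impl. intros w. apply in_family_stage. lia. }
  destruct K as [n K]. exists n. clear H.
  induction K as [|v l [j ->] _ [l' ->]]; [now exists []|now exists (j :: l')].
Qed.

Lemma hull_witness d e t l : Forall (in_hull d e) l -> in_hull d e (witness d t l).
Proof.
  intros H. destruct (hull_list _ _ _ H) as (n & l' & ->). exists (S n). simpl.
  destruct (stage d e n) as [J g]. now exists (inr (t, l')).
Qed.

Lemma hull_params d e i : in_hull d e (scons d e i).
Proof. now exists 0, i. Qed.

Lemma force_scons p d a l x :
  force p (listenv d (a :: l)) x <-> force p (scons a (listenv d l)) x.
Proof. apply force_env. now intros [|i]. Qed.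

(** The Tarski-Vaught criterion.  A universal statement is checked at each point
    of a neighbourhood separately, where a counterexample can be taken in the
    hull; an existential one is true at a point through a single witness. *)
Lemma hull_reflects d e p : forall k r zi e' l x,
  bounded k p -> (forall i, i < k -> e' (r i) = nth i l d) -> e' zi = hullV d e ->
  Forall (in_hull d e) l ->
  (force (relativize zi (ren r p)) e' x <-> force p (listenv d l) x).
Proof.
  assert (X : forall k r (e' : nat -> V) l a, (forall i, i < k -> e' (r i) = nth i l d) ->
    forall i, i < S k -> scons a e' (up r i) = nth i (a :: l) d).
  { intros k r e' l a H [|i] Hi; simpl; auto. apply H. apply Nat.succ_lt_mono, Hi. }
  assert (M : forall w y, in_hull d e w -> memV w (hullV d e) y).
  { intros w y Hw. apply mem_hullV. exists w. auto using eqV_refl. }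
  assert (R : forall q (e' : nat -> V) a w y, eqV a w y ->
    force q (scons w e') y -> force q (scons a e') y).
  { intros q e' a w y E. apply (proj2 (openP_force q e')). now apply eqV_sym. }
  induction p; simpl; intros k r zi e' l x Hb He Hz Hl.
  - tauto.
  - unfold listenv. now rewrite !He by tauto.
  - unfold listenv. now rewrite !He by tauto.
  - rewrite (IHp1 k r zi e' l), (IHp2 k r zi e' l); tauto.
  - rewrite (IHp1 k r zi e' l), (IHp2 k r zi e' l); tauto.
  - apply box_iff. intros y. rewrite (IHp1 k r zi e' l), (IHp2 k r zi e' l); tauto.
  - split; apply box_mono; intros y H a.
    + apply NNPP. intros C.
      set (w := witness d (y, p, false) l).
      assert (Hw : in_hull d e w) by now apply hull_witness.
      assert (Cw : ~ force p (listenv d (w :: l)) y).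
      { unfold w, witness. apply epsilon_spec. exists a. now rewrite force_scons. }
      apply Cw. apply (IHp (S k) (up r) (S zi) (scons w e') (w :: l)); eauto.
      apply (box_elim _ _ (H w)). simpl. rewrite Hz. auto.
    + specialize (H a). pose proof (force_box _ _ _ H) as H'. revert H'.
      apply box_mono. intros y' H' Ha. simpl in Ha. rewrite Hz in Ha.
      apply mem_hullV in Ha as (w & Hw & E). apply (R _ _ _ _ _ E).
      apply (IHp (S k) (up r) (S zi) (scons w e') (w :: l)); eauto.
      apply force_scons. eapply R; [apply eqV_sym|]; eauto.
  - split.
    + intros (a & Ha & H). simpl in Ha. rewrite Hz in Ha.
      apply mem_hullV in Ha as (w & Hw & E). exists w. apply force_scons.
      apply (IHp (S k) (up r) (S zi) (scons w e') (w :: l)); eauto.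
      eapply R; [apply eqV_sym|]; eauto.
    + intros [a H].
      set (w := witness d (x, p, true) l).
      assert (Hw : in_hull d e w) by now apply hull_witness.
      exists w. simpl. rewrite Hz. split; auto.
      apply (IHp (S k) (up r) (S zi) (scons w e') (w :: l)); eauto.
      unfold w, witness. apply epsilon_spec. exists a. now rewrite force_scons.
Qed.

Lemma force_bounded p : forall k e e' x, bounded k p ->
  (forall i, i < k -> e i = e' i) -> force p e x <-> force p e' x.
Proof.
  assert (X : forall k (e e' : nat -> V) a, (forall i, i < k -> e i = e' i) ->
    forall i, i < S k -> scons a e i = scons a e' i).
  { intros k e e' a H [|i] Hi; simpl; auto. apply H. lia. }
  induction p; simpl; intros k e e' x Hb He.
  - tauto.
  - now rewrite !He by tauto.
  - now rewrite !He by tauto.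
  - rewrite (IHp1 k e e'), (IHp2 k e e'); tauto.
  - rewrite (IHp1 k e e'), (IHp2 k e e'); tauto.
  - apply box_iff. intros y. rewrite (IHp1 k e e'), (IHp2 k e e'); tauto.
  - apply box_iff. intros y. split; intros H a;
      apply (IHp (S k) (scons a e) (scons a e')); eauto.
  - split; intros [a H]; exists a; apply (IHp (S k) (scons a e) (scons a e')); eauto.
Qed.

Lemma force_pars_in n : forall v d e x,
  (forall m, m < n -> memV (e (d + m)) (e (v d)) x) -> force (pars_in n v d) e x.
Proof.
  induction n as [|n IH]; simpl; intros v d e x H.
  - apply box_all. auto.
  - split; [apply IH; intros m Hm|]; apply H; lia.
Qed.

Lemma force_ax_reflection n p e x :
  bounded (S n) p -> force (ax_reflection n p) e x.
Proof.
  intros Hb. unfold ax_reflection, sentence.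
  cbn -[plug frel pars_in]. apply box_all. intros x1 z.
  exists (hullV z e). split; [|split; [|split]].
  - apply box_all. intros y1 a. apply box_all. intros y2 Ha.
    apply (box1 _ _ _ (memV_box _ _ _ Ha)). clear y2 Ha. intros y2 Ha b.
    apply (box1 _ _ _ Ha). clear y2 Ha. intros y2 Ha Hb'.
    apply box_elim, mem_hullV in Ha as (w & Hw & E).
    apply (memV_r _ _ _ _ E) in Hb'. apply mem_hullV.
    pose proof (hull_child z e w) as C.
    destruct w as [A f F]. destruct Hb' as (i & Hi & Ei). exists (f i).
    split; [exact (C i Hw)|exact Ei].
  - apply mem_hullV. exists z. split; [apply (hull_params z e 0)|apply eqV_refl].
  - apply force_pars_in. intros m _. apply mem_hullV. exists (e m).
    split; [apply (hull_params z e (S m))|apply eqV_refl].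
  - apply box_all. intros y1 a. apply box_all. intros y2 Ha.
    assert (K : forall y, memV a (hullV z e) y ->
      (force (plug p [bound 2] 3) (scons a (scons (hullV z e) (scons z e))) y <->
       force (frel (bound 1) (plug p [bound 2]) 3) (scons a (scons (hullV z e) (scons z e))) y)).
    { clear y2 Ha. intros y Ha. apply mem_hullV in Ha as (w & Hw & E).
      assert (T : forall q, force q (scons a (scons (hullV z e) (scons z e))) y <->
                            force q (scons w (scons (hullV z e) (scons z e))) y).
      { intros q. split; apply (proj2 (openP_force q _)); auto using eqV_sym. }
      rewrite !T, force_plug1. unfold frel, plug.
      rewrite (hull_reflects z e p (S n) _ _ _ (w :: map e (seq 0 n))); auto.
      - apply (force_bounded p (S n)); auto. intros [|i] Hi; cbn; auto.
        unfold listenv. simpl.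
        rewrite nth_indep with (d' := e 0) by (rewrite length_map, length_seq; lia).
        rewrite map_nth, seq_nth by lia. reflexivity.
      - intros [|i] Hi; cbn; auto.
        rewrite nth_indep with (d' := e 0) by (rewrite length_map, length_seq; lia).
        rewrite map_nth, seq_nth by lia. destruct i; reflexivity.
      - constructor; auto. apply Forall_forall. intros v Hv.
        apply in_map_iff in Hv as (i & <- & _). apply (hull_params z e (S i)). }
    split; apply (box1 _ _ _ (memV_box _ _ _ Ha));
      intros y Hy; apply box_elim, K in Hy; apply Hy.
Qed.

Lemma force_IZF_Ref p : IZF_Ref p -> forall e x, force p e x.
Proof.
  destruct 1; intros e x;
    auto using force_ax_ext, force_ax_empty, force_ax_pairing, force_ax_union,
      force_ax_infinity, force_ax_power, force_ax_set_induction, force_ax_separation,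
      force_ax_reflection.
Qed.

(** * From formulas to conditions on names *)

(** [extends d e d' e'] holds when [d'], [e'] arise from the depth [d] and the
    environment [e] by entering further binders. *)
Inductive extends : nat -> (nat -> V) -> nat -> (nat -> V) -> Prop :=
| extends_refl d e : extends d e d e
| extends_push d e d' e' a :
    extends d e d' e' -> extends d e (S d') (scons a e').

Lemma extends_trans d e d' e' d'' e'' :
  extends d e d' e' -> extends d' e' d'' e'' -> extends d e d'' e''.
Proof. intros H. induction 1; auto. constructor. auto. Qed.

(** A [var] depends on the depth, and so denotes a name only relative to a depth
    and an environment; requiring the same at all later depths lets the fact be
    used under binders. *)
Definition den (d : nat) (e : nat -> V) (x : var) (v : V) : Prop :=
  forall d' e', extends d e d' e' -> e' (x d') = v.
(** [means d e p P] replaces the formula [p] by a condition [P] on points.  The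
    lemmas about [means] translate every notion of the theory into a short
    condition on names; [means1] and [means2] do so for formulas with one or two
    arguments. *)
Definition means (d : nat) (e : nat -> V) (p : fml) (P : pt -> Prop) : Prop :=
  forall x, force (p d) e x <-> P x.
Definition means1 d e (A : var -> fml) (P : V -> pt -> Prop) : Prop :=
  forall d' e', extends d e d' e' ->
  forall x v, den d' e' x v -> means d' e' (A x) (P v).
Definition means2 d e (A : var -> var -> fml) (P : V -> V -> pt -> Prop) : Prop :=
  forall d' e', extends d e d' e' ->
  forall x v y w, den d' e' x v -> den d' e' y w -> means d' e' (A x y) (P v w).

Lemma den_extends d e d' e' x v : extends d e d' e' -> den d e x v -> den d' e' x v.
Proof. intros H H' d'' e'' H''. apply H'. eapply extends_trans; eauto. Qed.

Lemma den_push d e x v a : den d e x v -> den (S d) (scons a e) x v.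
Proof. apply den_extends. repeat constructor. Qed.

Lemma den_bound d e a : den (S d) (scons a e) (bound d) a.
Proof.
  intros d' e' H. remember (S d) as k. remember (scons a e) as e0.
  assert (K : S d <= d' /\ e' (bound d d') = a); [|tauto].
  induction H as [|? ? ? ? ? H IH]; subst; unfold bound.
  - split; auto. now rewrite Nat.sub_diag.
  - destruct IH as [L IH]; auto. split; [lia|].
    unfold bound in IH. rewrite Nat.sub_succ_l by lia. exact IH.
Qed.

(** The conditions are found by unification: each clause below fixes the shape
    of the condition from the head of the formula.  Under a binder the unknown
    condition is applied to the bound name, hence [rapply], which solves such
    pattern equations. *)
Create HintDb means discriminated.
Hint Constants Opaque : means.
Hint Variables Opaque : means.

Ltac den := first
  [ eassumption | apply den_bound | apply den_push; den
  | eapply den_extends; [eassumption|]; den ].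
Hint Extern 0 (den _ _ _ _) => den : means.

Lemma means_iff d e p P P' : means d e p P -> (forall x, P x <-> P' x) -> means d e p P'.
Proof. intros H K x. now rewrite (H x). Qed.

Lemma means1_intro d e A P :
  (forall d' e', extends d e d' e' -> forall x v, den d' e' x v -> means d' e' (A x) (P v)) ->
  means1 d e A P.
Proof. exact (fun H => H). Qed.
Lemma means2_intro d e A P :
  (forall d' e', extends d e d' e' -> forall x v y w, den d' e' x v -> den d' e' y w ->
    means d' e' (A x y) (P v w)) ->
  means2 d e A P.
Proof. exact (fun H => H). Qed.

Lemma means_bot d e : means d e fbot (fun _ => False).
Proof. intros x. reflexivity. Qed.
Lemma den_here d e x v : den d e x v -> e (x d) = v.
Proof. intros H. apply H. constructor. Qed.
Lemma means_eq d e x y v w : den d e x v -> den d e y w ->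
  means d e (feq x y) (eqV v w).
Proof. intros H K z. simpl. now rewrite (den_here _ _ _ _ H), (den_here _ _ _ _ K). Qed.
Lemma means_mem d e x y v w : den d e x v -> den d e y w ->
  means d e (fmem x y) (memV v w).
Proof. intros H K z. simpl. now rewrite (den_here _ _ _ _ H), (den_here _ _ _ _ K). Qed.
Lemma means_and d e p q P Q : means d e p P -> means d e q Q ->
  means d e (fand p q) (fun x => P x /\ Q x).
Proof. intros H K z. simpl. now rewrite (H z), (K z). Qed.
Lemma means_or d e p q P Q : means d e p P -> means d e q Q ->
  means d e (for_ p q) (fun x => P x \/ Q x).
Proof. intros H K z. simpl. now rewrite (H z), (K z). Qed.
Lemma means_imp d e p q P Q : means d e p P -> means d e q Q ->
  means d e (fimp p q) (box (fun x => P x -> Q x)).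
Proof. intros H K z. apply box_iff. intros y. now rewrite (H y), (K y). Qed.
Lemma means_all d e f F :
  (forall a, means (S d) (scons a e) (f (bound d)) (F a)) ->
  means d e (fall f) (box (fun y => forall a, F a y)).
Proof. intros H z. apply box_iff. intros y. split; intros K a; apply H, K. Qed.
Lemma means_ex d e f F :
  (forall a, means (S d) (scons a e) (f (bound d)) (F a)) ->
  means d e (fex f) (fun x => exists a, F a x).
Proof. intros H z. split; intros [a K]; exists a; apply H, K. Qed.
Lemma means_all_pred d e A P f F : means1 d e A P ->
  (forall a, means (S d) (scons a e) (f (bound d)) (F a)) ->
  means d e (fall_in A f) (box (fun y => forall a, box (fun z => P a z -> F a z) y)).
Proof.
  intros HA H. apply means_all. intros a. apply means_imp; auto.
  apply HA; [repeat constructor|apply den_bound].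
Qed.
Lemma means_ex_pred d e A P f F : means1 d e A P ->
  (forall a, means (S d) (scons a e) (f (bound d)) (F a)) ->
  means d e (fex_in A f) (fun x => exists a, P a x /\ F a x).
Proof.
  intros HA H. apply (means_ex _ _ _ (fun a x => P a x /\ F a x)). intros a.
  apply means_and; auto. apply HA; [repeat constructor|apply den_bound].
Qed.

Lemma means1_elt d e x v : den d e x v -> means1 d e (elt x) (fun a => memV a v).
Proof. intros H d' e' K y w H'. apply means_mem; den. Qed.

Hint Extern 1 (means _ _ fbot _) => rapply means_bot : means.
Hint Extern 1 (means _ _ (feq _ _) _) => rapply means_eq : means.
Hint Extern 1 (means _ _ (fmem _ _) _) => rapply means_mem : means.
Hint Extern 1 (means _ _ (fand _ _) _) => rapply means_and : means.
Hint Extern 1 (means _ _ (for_ _ _) _) => rapply means_or : means.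
Hint Extern 1 (means _ _ (fimp _ _) _) => rapply means_imp : means.
Hint Extern 1 (means _ _ (fall _) _) => rapply means_all : means.
Hint Extern 1 (means _ _ (fex _) _) => rapply means_ex : means.
Hint Extern 1 (means1 _ _ (elt _) _) => rapply means1_elt : means.
Hint Extern 9 (means _ _ (fall_in _ _) _) => rapply means_all_pred : means.
Hint Extern 9 (means _ _ (fex_in _ _) _) => rapply means_ex_pred : means.

Ltac meaning := eauto 60 with means nocore.
Ltac by_meaning D := intros; eapply means_iff; [unfold D; meaning|intros ?z].

Lemma means_force d e p P x : means d e p P -> force (p d) e x -> P x.
Proof. intros H. apply H. Qed.

(** A condition that expresses a formula inherits openness and invariance under
    equality from it. *)
Lemma means_openP d e p P :
  (forall a, means (S d) (scons a e) p (P a)) -> openP P.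
Proof.
  intros H. destruct (openP_force (p (S d)) e) as [K1 K2]. split.
  - intros a x K. apply H in K. apply K1 in K. revert K. apply box_mono.
    intros y K. now apply H.
  - intros a b x E K. apply H. apply H in K. eapply K2; eauto.
Qed.

Lemma means_of_1 d e A P x v : means1 d e A P -> den d e x v -> means d e (A x) (P v).
Proof. intros H. apply H. constructor. Qed.

Lemma means1_extends d e d' e' A P : extends d e d' e' -> means1 d e A P -> means1 d' e' A P.
Proof. intros H K d2 e2 H2. apply K. eapply extends_trans; eauto. Qed.

Lemma means1_push d e a A P : means1 d e A P -> means1 (S d) (scons a e) A P.
Proof. apply means1_extends. repeat constructor. Qed.

Lemma means2_elim d e A P d' e' x y v w : means2 d e A P -> extends d e d' e' ->
  den d' e' x v -> den d' e' y w -> means d' e' (A x y) (P v w).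
Proof. intros H K. apply H, K. Qed.

(* Proof search must not unfold these and introduce the points behind them. *)
#[local] Opaque means means1 means2 den.

(** A family of names no two of which are equal at any point.  A quantifier over
    such a family turns into one over its indices, which do not depend on the
    point. *)
Record discrete : Type := Disc {
  idx : Set;
  allowed : idx -> Prop;
  name_of : idx -> V;
  name_of_inj : forall i j x, allowed i -> allowed j -> eqV (name_of i) (name_of j) x -> i = j }.

Definition inD (D : discrete) (v : V) (x : pt) : Prop :=
  exists i, allowed D i /\ eqV v (name_of D i) x.

Lemma inD_name D i x : allowed D i -> inD D (name_of D i) x.
Proof. intros H. exists i. auto using eqV_refl. Qed.

Lemma means_all_discrete d e A D f F : means1 d e A (inD D) ->
  (forall a, means (S d) (scons a e) (f (bound d)) (F a)) ->
  means d e (fall_in A f) (box (fun y => forall i, allowed D i -> F (name_of D i) y)).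
Proof.
  intros HA H. eapply means_iff; [eapply means_all_pred; eassumption|].
  destruct (means_openP _ _ _ _ H) as [_ K]. intros x. split.
  - apply box_mono. intros y Hy i Hi. apply (box_elim _ _ (Hy _)), inD_name, Hi.
  - intros Hx. apply (box1 _ _ _ Hx). intros y Hy a. apply (box1 _ _ _ Hy).
    intros z Hz (i & Hi & E). apply box_elim in Hz.
    apply (K (name_of D i)); auto using eqV_sym.
Qed.

Lemma means_ex_discrete d e A D f F : means1 d e A (inD D) ->
  (forall a, means (S d) (scons a e) (f (bound d)) (F a)) ->
  means d e (fex_in A f) (fun x => exists i, allowed D i /\ F (name_of D i) x).
Proof.
  intros HA H. eapply means_iff; [eapply means_ex_pred; eassumption|].
  destruct (means_openP _ _ _ _ H) as [_ K]. intros x. split.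
  - intros (a & (i & Hi & E) & Ha). exists i. split; auto. eapply K; eauto.
  - intros (i & Hi & Hx). exists (name_of D i). split; auto using inD_name.
Qed.

Lemma means_ex_eq d e A c f F : means1 d e A (fun v => eqV v c) ->
  (forall a, means (S d) (scons a e) (f (bound d)) (F a)) ->
  means d e (fex_in A f) (F c).
Proof.
  intros HA H. eapply means_iff; [eapply means_ex_pred; eassumption|].
  destruct (means_openP _ _ _ _ H) as [_ K]. intros x. split.
  - intros (a & E & Ha). eapply K; eauto.
  - intros Hx. exists c. auto using eqV_refl.
Qed.
Hint Extern 5 (means _ _ (fall_in _ _) _) => rapply means_all_discrete : means.
Hint Extern 5 (means _ _ (fex_in _ _) _) => rapply means_ex_discrete : means.
Hint Extern 5 (means _ _ (fex_in _ _) _) => rapply means_ex_eq : means.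

(** Names are often specified by their members, as in [is_upair] or [rat_of]; such
    a specification says that they equal a given name with these members. *)
Lemma by_extension c Phi v x : box (fun y => forall a, memV a c y <-> Phi a y) x ->
  (box (fun y => forall a, box (fun z => memV a v z -> Phi a z) y /\
                           box (fun z => Phi a z -> memV a v z) y) x <-> eqV v c x).
Proof.
  intros H. split.
  - intros K. apply eqV_intro. apply (box2 _ _ _ _ H K). intros y Hy Ky a.
    apply box_elim in Hy, Ky. rewrite Hy. destruct (Ky a) as [H1 H2].
    apply box_elim in H1, H2. split; auto.
  - intros E. apply eqV_box in E. apply (box2 _ _ _ _ H E). intros y Hy Ky a. split;
      apply (box2 _ _ _ _ Hy Ky); intros z Hz Kz; apply box_elim in Hz, Kz; rewrite <- Hz;
      apply memV_r; auto using eqV_sym.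
Qed.

Lemma means1_is_empty d e : means1 d e is_empty (fun v => eqV v (hat 0)).
Proof.
  apply means1_intro. intros d' e' _ x v Hx. by_meaning is_empty. split.
  - intros H. apply eqV_intro. apply (box1 _ _ _ H). intros y Hy a.
    apply box_elim in Hy. split; intros K.
    + now apply (box_elim _ _ (Hy a)) in K.
    + now apply mem_emptyV in K.
  - intros E. apply eqV_box in E. apply (box1 _ _ _ E). intros y Hy a.
    apply (box1 _ _ _ Hy). intros u Hu K. apply box_elim in Hu.
    apply (mem_emptyV a u). eapply memV_r; eauto.
Qed.
Lemma means_is_empty d e x v : den d e x v -> means d e (is_empty x) (eqV v (hat 0)).
Proof. apply (means_of_1 _ _ _ _ _ _ (means1_is_empty d e)). Qed.
Hint Extern 1 (means1 _ _ is_empty _) => rapply means1_is_empty : means.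
Hint Extern 1 (means _ _ (is_empty _) _) => rapply means_is_empty : means.

Lemma means_subset d e x y v w : den d e x v -> den d e y w ->
  means d e (subset x y) (box (fun y => forall a, memV a v y -> memV a w y)).
Proof.
  by_meaning subset. split.
  - apply box_mono. intros u Hu a. apply (box_elim _ _ (Hu a)).
  - intros K. apply (box1 _ _ _ K). intros u Hu a. apply (box1 _ _ _ Hu).
    intros u' Hu'. apply box_elim in Hu'. auto.
Qed.
Hint Extern 1 (means _ _ (subset _ _) _) => rapply means_subset : means.

Lemma means_is_upair d e x y p a b c : den d e x a -> den d e y b -> den d e p c ->
  means d e (is_upair x y p) (eqV c (upairV a b)).
Proof. by_meaning is_upair. apply by_extension, box_all. intros. apply mem_upairV. Qed.
Hint Extern 1 (means _ _ (is_upair _ _ _) _) => rapply means_is_upair : means.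

Lemma upairV_congr a a' b b' x :
  eqV a a' x -> eqV b b' x -> eqV (upairV a b) (upairV a' b') x.
Proof.
  intros H K. apply eqV_intro.
  apply (box2 _ _ _ _ (eqV_box _ _ _ H) (eqV_box _ _ _ K)). intros y Hy Ky z.
  apply box_elim in Hy, Ky. rewrite !mem_upairV.
  split; intros [E|E]; eauto using eqV_trans, eqV_sym.
Qed.

Lemma upairV_eq a b c d x : eqV (upairV a b) (upairV c d) x ->
  (eqV a c x \/ eqV a d x) /\ (eqV b c x \/ eqV b d x) /\
  (eqV c a x \/ eqV c b x) /\ (eqV d a x \/ eqV d b x).
Proof.
  intros E. pose proof (eqV_sym _ _ _ E) as E'.
  rewrite <- !mem_upairV.
  repeat split; (eapply memV_r; [eassumption|]); apply mem_upairV; auto using eqV_refl.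
Qed.

Definition pairV (a b : V) : V := upairV (upairV a a) (upairV a b).

Lemma pairV_congr a a' b b' x :
  eqV a a' x -> eqV b b' x -> eqV (pairV a b) (pairV a' b') x.
Proof. intros. repeat apply upairV_congr; auto. Qed.

(** Equality with a member of an unordered pair is a disjunction, hence decided
    at each point; so the usual case analysis is valid pointwise. *)
Lemma pairV_inj a b c d x : eqV (pairV a b) (pairV c d) x -> eqV a c x /\ eqV b d x.
Proof.
  intros E. apply upairV_eq in E. destruct E as (E1 & E2 & _ & E4).
  assert (A : eqV a c x).
  { destruct E1 as [E1|E1]; apply upairV_eq in E1; destruct E1 as (H1 & _ & H2 & _);
      [tauto|destruct H2; apply eqV_sym; auto]. }
  split; auto.
  assert (A' := eqV_sym _ _ _ A).
  destruct E2 as [E2|E2]; apply upairV_eq in E2; destruct E2 as (_ & H2 & _ & H3).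
  - assert (B : eqV b c x) by tauto.
    destruct E4 as [E4|E4]; apply upairV_eq in E4; destruct E4 as (_ & H4 & _ & _).
    + assert (eqV d a x) by tauto. eauto using eqV_trans, eqV_sym.
    + destruct H4; eauto using eqV_trans, eqV_sym.
  - destruct H2; auto. destruct H3; eauto using eqV_trans, eqV_sym.
Qed.

Lemma means_is_pair d e x y p a b c : den d e x a -> den d e y b -> den d e p c ->
  means d e (is_pair x y p) (eqV c (pairV a b)).
Proof.
  by_meaning is_pair. split.
  - intros (u & v & Hu & Hv & E). eapply eqV_trans; [exact E|]. now apply upairV_congr.
  - intros E. exists (upairV a a), (upairV a b). auto using eqV_refl.
Qed.
Hint Extern 1 (means _ _ (is_pair _ _ _) _) => rapply means_is_pair : means.

Lemma means_is_succ d e x y a b : den d e x a -> den d e y b ->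
  means d e (is_succ x y) (eqV b (succV a)).
Proof. by_meaning is_succ. apply by_extension, box_all. intros. apply mem_succV. Qed.
Hint Extern 1 (means _ _ (is_succ _ _) _) => rapply means_is_succ : means.

Lemma means_app d e f x y g a b : den d e f g -> den d e x a -> den d e y b ->
  means d e (app f x y) (memV (pairV a b) g).
Proof.
  by_meaning app. split.
  - intros (p & Hp & E). eapply memV_l; eauto.
  - intros K. exists (pairV a b). auto using eqV_refl.
Qed.
Hint Extern 1 (means _ _ (app _ _ _) _) => rapply means_app : means.

(** * Natural numbers *)

Lemma succV_congr a b x : eqV a b x -> eqV (succV a) (succV b) x.
Proof.
  intros E. apply eqV_intro. apply (box1 _ _ _ (eqV_box _ _ _ E)). intros y Ey c.
  apply box_elim in Ey. rewrite !mem_succV.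
  split; (intros [K|K]; [left|right]); eauto using memV_r, eqV_trans, eqV_sym.
Qed.

Lemma mem_hat z n x : memV z (hat n) x <-> exists k, k < n /\ eqV z (hat k) x.
Proof.
  induction n as [|n IH]; simpl.
  - split; [intros K; now apply mem_emptyV in K|intros (k & Hk & _); lia].
  - rewrite mem_succV, IH. split.
    + intros [(k & Hk & E)|E]; eauto.
    + intros (k & Hk & E). destruct (Nat.eq_dec k n) as [->|]; auto.
      left. exists k. split; auto. lia.
Qed.

(** If [k < i] and the numerals are equal at [x], then [hat k] belongs to itself
    there, hence equals a smaller numeral, and so on downwards. *)
Lemma hat_inj i j x : eqV (hat i) (hat j) x -> i = j.
Proof.
  assert (K : forall i k, k < i -> ~ eqV (hat i) (hat k) x).
  { clear i j. intros i. induction i as [i IH] using lt_wf_ind. intros k Hk E.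
    assert (M : memV (hat k) (hat i) x) by (apply mem_hat; eauto using eqV_refl).
    apply (memV_r _ _ _ _ E), mem_hat in M as (k' & Hk' & E'). exact (IH k Hk k' Hk' E'). }
  intros E. destruct (Nat.lt_trichotomy i j) as [L|[L|L]]; auto; exfalso.
  - eapply K; [exact L|]. now apply eqV_sym.
  - eapply K; eauto.
Qed.

Lemma mem_hat_hat i j x : memV (hat i) (hat j) x <-> i < j.
Proof.
  rewrite mem_hat. split.
  - intros (k & Hk & E). now apply hat_inj in E as ->.
  - eauto using eqV_refl.
Qed.

Definition natD : discrete := Disc nat (fun _ => True) hat (fun i j x _ _ => hat_inj i j x).
Definition posnatD : discrete :=
  Disc nat (fun i => 0 < i) hat (fun i j x _ _ => hat_inj i j x).

Definition inductiveV (w : V) (x : pt) : Prop :=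
  memV (hat 0) w x /\
  box (fun y => forall a, memV a w y -> memV (succV a) w y) x.

Lemma means1_inductive d e : means1 d e inductive inductiveV.
Proof.
  apply means1_intro. intros d' e' _ x v Hx. by_meaning inductive. split; (intros [H K]; split).
  - destruct H as (a & H & E). eapply memV_l; eauto.
  - revert K. apply box_mono. intros y Hy a Ha.
    destruct (box_elim _ _ (Hy a) Ha) as (b & Hb & E). eapply memV_l; eauto.
  - exists (hat 0). auto using eqV_refl.
  - apply (box1 _ _ _ K). intros y Hy a. apply (box1 _ _ _ Hy).
    intros u Hu Ha. apply box_elim in Hu. eauto using eqV_refl.
Qed.
Lemma means_inductive d e x v : den d e x v -> means d e (inductive x) (inductiveV v).
Proof. apply (means_of_1 _ _ _ _ _ _ (means1_inductive d e)). Qed.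
Hint Extern 1 (means1 _ _ inductive _) => rapply means1_inductive : means.
Hint Extern 1 (means _ _ (inductive _) _) => rapply means_inductive : means.

Lemma inductive_hat w x n : inductiveV w x -> memV (hat n) w x.
Proof. intros [H K]. apply box_elim in K. induction n; simpl; auto. Qed.

Lemma inductive_omegaV x : inductiveV omegaV x.
Proof.
  split.
  - apply mem_omegaV. exists 0. apply eqV_refl.
  - apply box_all. intros y a Ha. apply mem_omegaV in Ha as [n E].
    apply mem_omegaV. exists (S n). now apply succV_congr.
Qed.


Lemma inductiveV_open : openP inductiveV.
Proof.
  split.
  - intros a x [H1 H2]. apply box_and; [now apply memV_box|now apply box_box].
  - intros a b x E [H1 H2]. split; [eapply memV_r; eauto|].
    apply (box2 _ _ _ _ (eqV_box _ _ _ E) H2). intros y Ey Ky c Hc.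
    apply box_elim in Ey, Ky. eapply memV_r; [eassumption|].
    apply Ky. eapply memV_r; [apply eqV_sym|]; eauto.
Qed.

(** The existence of [omegaV] bounds a least inductive set from above, and
    induction in the metatheory puts every numeral into it. *)
Lemma means1_is_omega d e : means1 d e is_omega (fun v => eqV v omegaV).
Proof.
  apply means1_intro. intros d' e' _ x v Hx. by_meaning is_omega. split.
  - intros [H K]. apply eqV_intro. apply inductiveV_open in H.
    apply (box2 _ _ _ _ H K). clear H K. intros y H K a.
    apply box_elim in H, K. split.
    + intros Ha. exact (box_elim _ _ (box_elim _ _ (K omegaV) (inductive_omegaV y)) a Ha).
    + intros Ha. apply mem_omegaV in Ha as [n E].
      eapply memV_l; [apply eqV_sym; exact E|]. now apply inductive_hat.
  - intros E. split.
    + eapply inductiveV_open; [apply eqV_sym, E|apply inductive_omegaV].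
    + apply (box1 _ _ _ (eqV_box _ _ _ E)). intros y Ey a. apply (box1 _ _ _ Ey).
      intros u Eu Ha. apply inductiveV_open in Ha. apply (box2 _ _ _ _ Eu Ha).
      intros u' Eu' Ha' c Hc. apply box_elim in Eu', Ha'.
      apply (memV_r _ _ _ _ Eu'), mem_omegaV in Hc as [n E'].
      eapply memV_l; [apply eqV_sym; exact E'|]. now apply inductive_hat.
Qed.
Hint Extern 1 (means1 _ _ is_omega _) => rapply means1_is_omega : means.

Lemma means1_is_nat d e : means1 d e is_nat (inD natD).
Proof.
  apply means1_intro. intros d' e' _ x v Hx. by_meaning is_nat.
  rewrite mem_omegaV. split; intros [n E]; exists n; simpl in *; tauto.
Qed.
Hint Extern 1 (means1 _ _ is_nat _) => rapply means1_is_nat : means.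

Lemma means_is_nat d e x v : den d e x v -> means d e (is_nat x) (inD natD v).
Proof. apply (means_of_1 _ _ _ _ _ _ (means1_is_nat d e)). Qed.
Hint Extern 1 (means _ _ (is_nat _) _) => rapply means_is_nat : means.

Lemma means1_is_one d e : means1 d e is_one (fun v => eqV v (hat 1)).
Proof. apply means1_intro. intros d' e' _ x v Hx. by_meaning is_one. reflexivity. Qed.
Hint Extern 1 (means1 _ _ is_one _) => rapply means1_is_one : means.

Lemma means1_is_posnat d e : means1 d e is_posnat (inD posnatD).
Proof.
  apply means1_intro. intros d' e' _ x v Hx. by_meaning is_posnat. split.
  - intros [(n & _ & E) H]. apply (memV_r _ _ _ _ E), mem_hat_hat in H. now exists n.
  - intros (n & Hn & E). split; [now exists n|].
    eapply memV_r; [apply eqV_sym, E|]. now apply mem_hat_hat.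
Qed.
Lemma means_is_posnat d e x v : den d e x v -> means d e (is_posnat x) (inD posnatD v).
Proof. apply (means_of_1 _ _ _ _ _ _ (means1_is_posnat d e)). Qed.
Hint Extern 1 (means1 _ _ is_posnat _) => rapply means1_is_posnat : means.
Hint Extern 1 (means _ _ (is_posnat _) _) => rapply means_is_posnat : means.


(** * Functions between discrete families *)

(** The meaning of being a function between discrete families.  Uniqueness of
    values is stated for indices, where it is an equation of the metatheory. *)
Definition funD (D1 D2 : discrete) (f : V) : pt -> Prop := box (fun y =>
  (forall p, memV p f y ->
     exists i j, allowed D1 i /\ allowed D2 j /\ eqV p (pairV (name_of D1 i) (name_of D2 j)) y) /\
  (forall i, allowed D1 i -> exists j, allowed D2 j /\ memV (pairV (name_of D1 i) (name_of D2 j)) f y /\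
     forall j', allowed D2 j' -> memV (pairV (name_of D1 i) (name_of D2 j')) f y -> j' = j)).

Ltac means1_hyp := first [eassumption | apply means1_push; means1_hyp].
Hint Extern 2 (means1 _ _ _ _) => means1_hyp : means.

Lemma means_is_fun d e A B f D1 D2 v :
  means1 d e A (inD D1) -> means1 d e B (inD D2) -> den d e f v ->
  means d e (is_fun A B f) (funD D1 D2 v).
Proof.
  intros HA HB Hf. eapply means_iff; [unfold is_fun, fex_unique; meaning|].
  intros x. split.
  - intros [H K]. apply (box2 _ _ _ _ H K). clear H K x. intros y H K.
    apply box_elim in H. split.
    + intros p Hp. destruct (box_elim _ _ (H p) Hp) as (i & Hi & j & Hj & E). eauto.
    + intros i Hi. destruct (box_elim _ _ K i Hi) as (b & Hb & Hu).
      destruct (box_elim _ _ (H _) Hb) as (i' & Hi' & j & Hj & E).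
      apply pairV_inj in E as [_ E]. exists j. repeat split; auto.
      * eapply memV_l; [|exact Hb]. apply pairV_congr; auto using eqV_refl.
      * intros j' Hj' Hb'. apply (name_of_inj D2 j' j y); auto.
        eapply eqV_trans; [|exact E]. apply box_elim in Hu.
        exact (box_elim _ _ (Hu _) Hb').
  - intros H. split; apply (box1 _ _ _ H); clear H x.
    + intros y H p. apply (box1 _ _ _ H). clear y H. intros y H Hp.
      apply box_elim in H. destruct H as [H _].
      destruct (H p Hp) as (i & j & Hi & Hj & E). eauto.
    + intros y H i Hi. destruct (box_elim _ _ H) as [_ K].
      destruct (K i Hi) as (j & Hj & Hm & _). clear K. exists (name_of D2 j). split; auto.
      apply (box2 _ _ _ _ H (memV_box _ _ _ Hm)). clear y H Hm. intros y H Hm b.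
      apply (box2 _ _ _ _ H Hm). clear y H Hm. intros y H Hm Hb.
      apply box_elim in H, Hm. destruct H as [H1 H2].
      destruct (H1 _ Hb) as (i' & j' & Hi' & Hj' & E).
      apply pairV_inj in E as [Ei Ej].
      destruct (H2 i Hi) as (j2 & Hj2 & _ & Hu).
      rewrite (Hu j Hj Hm), <- (Hu j' Hj'); auto.
      eapply memV_l; [|exact Hb]. apply pairV_congr; auto using eqV_refl.
Qed.
Hint Extern 1 (means _ _ (is_fun _ _ _) _) => rapply means_is_fun : means.

Lemma means1_is_fun d e A B D1 D2 : means1 d e A (inD D1) -> means1 d e B (inD D2) ->
  means1 d e (is_fun A B) (funD D1 D2).
Proof.
  intros HA HB. apply means1_intro. intros d' e' H x v Hx.
  apply means_is_fun; eauto using means1_extends.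
Qed.
Hint Extern 1 (means1 _ _ (is_fun _ _) _) => rapply means1_is_fun : means.

(** The function name whose value at [i] is [j] on the interior of [S i j]; with
    [S] depending on the point, its values are locally constant functions. *)
Definition funV (D1 D2 : discrete) (S : idx D1 -> idx D2 -> pt -> Prop) : V :=
  mk (idx D1 * idx D2) (fun p => pairV (name_of D1 (fst p)) (name_of D2 (snd p)))
     (fun p y => allowed D1 (fst p) /\ allowed D2 (snd p) /\ box (S (fst p) (snd p)) y).

Lemma mem_funV D1 D2 S p y : memV p (funV D1 D2 S) y <->
  exists i j, allowed D1 i /\ allowed D2 j /\ box (S i j) y /\ eqV p (pairV (name_of D1 i) (name_of D2 j)) y.
Proof.
  split.
  - intros ([i j] & H & E). apply box_elim in H. simpl in *. exists i, j. tauto.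
  - intros (i & j & Hi & Hj & H & E). exists (i, j). split; auto. simpl.
    apply box_box in H. revert H. apply box_mono. auto.
Qed.

Lemma mem_funV_name D1 D2 S i j y : allowed D1 i -> allowed D2 j ->
  memV (pairV (name_of D1 i) (name_of D2 j)) (funV D1 D2 S) y <-> box (S i j) y.
Proof.
  intros Hi Hj. rewrite mem_funV. split.
  - intros (i' & j' & Hi' & Hj' & H & E). apply pairV_inj in E as [Ei Ej].
    apply name_of_inj in Ei, Ej; auto. now subst.
  - intros H. exists i, j. auto using eqV_refl.
Qed.

Lemma funD_funV D1 D2 S x :
  box (fun y => forall i, allowed D1 i -> exists j, allowed D2 j /\ box (S i j) y /\
     forall j', allowed D2 j' -> box (S i j') y -> j' = j) x ->
  funD D1 D2 (funV D1 D2 S) x.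
Proof.
  apply box_mono. intros y H. split.
  - intros p Hp. apply mem_funV in Hp as (i & j & Hi & Hj & _ & E). eauto.
  - intros i Hi. destruct (H i Hi) as (j & Hj & Hm & Hu). exists j.
    repeat split; auto.
    + now apply mem_funV_name.
    + intros j' Hj' H'. apply mem_funV_name in H'; auto.
Qed.

(** Functions of the model are determined by the truth values of their graphs. *)
Lemma funV_of D1 D2 f x : funD D1 D2 f x ->
  eqV f (funV D1 D2 (fun i j => memV (pairV (name_of D1 i) (name_of D2 j)) f)) x.
Proof.
  intros H. apply eqV_intro. apply (box1 _ _ _ H). intros y Hy p.
  apply box_elim in Hy. rewrite mem_funV. split.
  - intros Hp. destruct Hy as [Hy _]. destruct (Hy p Hp) as (i & j & Hi & Hj & E).
    exists i, j. repeat split; auto. apply memV_box. eapply memV_l; eauto.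
  - intros (i & j & _ & _ & H' & E). apply box_elim in H'.
    eapply memV_l; [apply eqV_sym|]; eauto.
Qed.

(** * Arithmetic of the natural numbers *)

Definition iterateV (Step : V -> V -> pt -> Prop) (a n k : V) (x : pt) : Prop :=
  exists f, funD natD natD f x /\ memV (pairV (hat 0) a) f x /\
    box (fun y => forall i v v', memV (pairV (hat i) (hat v)) f y ->
      memV (pairV (hat (S i)) (hat v')) f y -> Step (hat v) (hat v') y) x /\
    memV (pairV n k) f x.

Ltac means2_hyp := match goal with
  | H : means2 _ _ ?s _ |- means _ _ (?s _ _) _ =>
      rapply (fun d' e' x y v w => means2_elim _ _ _ _ d' e' x y v w H)
  end.
Hint Extern 3 (means _ _ _ _) => means2_hyp : means.
Hint Extern 1 (extends _ _ _ _) => repeat constructor : means.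

Lemma means_iterate d e a step n k va Step vn vk :
  den d e a va -> means2 d e step Step -> den d e n vn -> den d e k vk ->
  means d e (iterate a step n k) (iterateV Step va vn vk).
Proof.
  intros Ha Hs Hn Hk.
  eapply means_iff; [unfold iterate; meaning|].
  intros x. split; intros (f & Hf & H0 & Hst & Hfn); exists f; repeat split; auto.
  - apply (box1 _ _ _ Hst). intros y Hy i v v' H1 H2.
    apply box_elim in Hy.
    pose proof (box_elim _ _ (Hy i I)) as K1. pose proof (box_elim _ _ (K1 (S i) I)) as K2.
    pose proof (box_elim _ _ (K2 v I)) as K3. pose proof (box_elim _ _ (K3 v' I)) as K4.
    pose proof (box_elim _ _ (K4 (eqV_refl _ _)) H1) as K5.
    exact (box_elim _ _ K5 H2).
  - apply (box1 _ _ _ Hst). intros y1 K1 i _. apply (box1 _ _ _ K1). intros y2 K2 i' _.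
    apply (box1 _ _ _ K2). intros y3 K3 v _. apply (box1 _ _ _ K3). intros y4 K4 v' _.
    apply (box1 _ _ _ K4). intros y5 K5 E. apply (box2 _ _ _ _ K5 (eqV_box _ _ _ E)).
    intros y6 K6 E6 M. apply (box3 _ _ _ _ _ K6 E6 (memV_box _ _ _ M)). intros y7 K7 E7 M7 M'.
    apply box_elim in K7, E7, M7. apply (hat_inj i' (S i)) in E7 as ->. eauto.
Qed.

(** A function of the model that follows the recursion takes the values of the
    iteration, by induction in the metatheory; conversely the constant graph of
    the iteration is such a function. *)
Lemma iterateV_hat Step g a n k x :
  box (fun y => forall v v', Step (hat v) (hat v') y <-> v' = g v) x ->
  iterateV Step a n k x <->
  exists a0 n0, eqV a (hat a0) x /\ eqV n (hat n0) x /\ eqV k (hat (Nat.iter n0 g a0)) x.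
Proof.
  intros HS. split.
  - intros (f & Hf & H0 & Hst & Hn). apply box_elim in Hf, Hst, HS.
    destruct Hf as [F1 F2].
    destruct (F1 _ H0) as (z & a0 & _ & _ & E0). apply pairV_inj in E0 as [Ez Ea].
    apply (hat_inj 0) in Ez as <-.
    destruct (F1 _ Hn) as (n0 & k0 & _ & _ & E). apply pairV_inj in E as [En Ek].
    exists a0, n0. repeat split; auto.
    assert (G : forall m, memV (pairV (hat m) (hat (Nat.iter m g a0))) f x).
    { induction m as [|m IH].
      - eapply memV_l; [|exact H0]. apply pairV_congr; auto using eqV_refl.
      - destruct (F2 (S m) I) as (v & _ & Hv & _).
        pose proof (Hst _ _ _ IH Hv) as St. apply HS in St. simpl. now rewrite <- St. }
    assert (Hn' : memV (pairV (hat n0) (hat k0)) f x).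
    { eapply memV_l; [|exact Hn]. now apply pairV_congr. }
    destruct (F2 n0 I) as (v & _ & _ & U).
    rewrite (U _ I (G n0)), <- (U _ I Hn'). exact Ek.
  - intros (a0 & n0 & Ea & En & Ek).
    exists (funV natD natD (fun i j _ => j = Nat.iter i g a0)).
    assert (M : forall i j y, memV (pairV (hat i) (hat j))
      (funV natD natD (fun i j _ => j = Nat.iter i g a0)) y <-> j = Nat.iter i g a0).
    { intros i j y. rewrite (mem_funV_name natD natD _ i j y I I). split.
      - apply box_elim.
      - intros E. apply box_all. auto. }
    split; [|split; [|split]].
    + apply funD_funV, box_all. intros y i _. exists (Nat.iter i g a0).
      split; [exact I|]. split; [now apply box_all|]. intros j _. apply box_elim.
    + eapply memV_l; [apply pairV_congr; [apply eqV_refl|apply eqV_sym, Ea]|].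
      now apply M.
    + revert HS. apply box_mono. intros y HS i v v' Hv Hv'.
      apply M in Hv, Hv'. apply HS. simpl in Hv'. now rewrite Hv.
    + eapply memV_l; [apply pairV_congr; apply eqV_sym; eassumption|]. now apply M.
Qed.

Definition addV (m n k : V) (x : pt) : Prop :=
  exists a b, eqV m (hat a) x /\ eqV n (hat b) x /\ eqV k (hat (a + b)) x.

Lemma means_nat_add d e m n k vm vn vk :
  den d e m vm -> den d e n vn -> den d e k vk ->
  means d e (nat_add m n k) (addV vm vn vk).
Proof.
  intros Hm Hn Hk. eapply means_iff.
  - unfold nat_add. apply means_iterate with (Step := fun v v' => eqV v' (succV v)); eauto.
    apply means2_intro. intros. now apply means_is_succ.
  - intros x. rewrite iterateV_hat with (g := S).
    + unfold addV. split; intros (a & b & Ha & Hb & E); exists a, b; repeat split; auto;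
        assert (Nat.iter b S a = a + b) as Q by
          (clear; induction b; simpl; lia); congruence.
    + apply box_all. intros y v v'. split.
      * intros E. now apply (hat_inj v' (S v)) in E.
      * intros ->. apply eqV_refl.
Qed.
Hint Extern 1 (means _ _ (nat_add _ _ _) _) => rapply means_nat_add : means.

Definition mulV (m n k : V) : pt -> Prop :=
  iterateV (fun v v' => addV v m v') (hat 0) n k.

Lemma means_nat_mul d e m n k vm vn vk :
  den d e m vm -> den d e n vn -> den d e k vk ->
  means d e (nat_mul m n k) (mulV vm vn vk).
Proof.
  intros Hm Hn Hk. unfold nat_mul.
  eapply (means_ex_eq _ _ _ _ _ (fun z => iterateV (fun v v' => addV v vm v') z vn vk));
    [meaning|].
  intros a. apply means_iterate; [meaning| |meaning|meaning].
  apply means2_intro. intros. apply means_nat_add; auto. den.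
Qed.
Hint Extern 1 (means _ _ (nat_mul _ _ _) _) => rapply means_nat_mul : means.

(** Near [x] the step of the recursion adds the fixed number [m0], since [m] keeps
    its value on a neighbourhood. *)
Lemma mulV_hat m m0 n n0 k x : eqV m (hat m0) x -> eqV n (hat n0) x ->
  mulV m n k x <-> eqV k (hat (m0 * n0)) x.
Proof.
  intros Em En. unfold mulV. rewrite iterateV_hat with (g := fun v => v + m0).
  - assert (Q : forall c, Nat.iter c (fun v => v + m0) 0 = m0 * c).
    { induction c; simpl; lia. }
    split.
    + intros (a & b & Ea & Eb & E). apply (hat_inj 0) in Ea as <-.
      assert (n0 = b) as ->; [|now rewrite <- Q].
      apply (hat_inj n0 b x). eapply eqV_trans; [apply eqV_sym|]; eauto.
    + intros E. exists 0, n0. rewrite Q. auto using eqV_refl.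
  - apply eqV_box in Em. revert Em. apply box_mono. intros y Em v v'. split.
    + intros (a & b & Ea & Eb & E). apply hat_inj in Ea, E. subst.
      f_equal. apply (hat_inj b m0 y). eapply eqV_trans; [apply eqV_sym|]; eauto.
    + intros ->. exists v, m0. auto using eqV_refl.
Qed.

Definition mulAddV (a b c d k : V) (x : pt) : Prop :=
  exists u v, mulV a b u x /\ mulV c d v x /\ addV u v k x.

Lemma means_nat_mul_add l e a b c d k va vb vc vd vk :
  den l e a va -> den l e b vb -> den l e c vc -> den l e d vd -> den l e k vk ->
  means l e (nat_mul_add a b c d k) (mulAddV va vb vc vd vk).
Proof. by_meaning nat_mul_add. reflexivity. Qed.
Hint Extern 1 (means _ _ (nat_mul_add _ _ _ _ _) _) => rapply means_nat_mul_add : means.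

Lemma mulAddV_hat a a0 b b0 c c0 d d0 k x :
  eqV a (hat a0) x -> eqV b (hat b0) x -> eqV c (hat c0) x -> eqV d (hat d0) x ->
  mulAddV a b c d k x <-> eqV k (hat (a0 * b0 + c0 * d0)) x.
Proof.
  intros Ea Eb Ec Ed. split.
  - intros (u & v & Hu & Hv & m & n & Em & En & E).
    apply (mulV_hat _ _ _ _ _ _ Ea Eb) in Hu. apply (mulV_hat _ _ _ _ _ _ Ec Ed) in Hv.
    assert (Hm : a0 * b0 = m).
    { apply (hat_inj _ _ x). eapply eqV_trans; [apply eqV_sym|]; eauto. }
    assert (Hn : c0 * d0 = n).
    { apply (hat_inj _ _ x). eapply eqV_trans; [apply eqV_sym|]; eauto. }
    now rewrite Hm, Hn.
  - intros E. exists (hat (a0 * b0)), (hat (c0 * d0)). repeat split.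
    + apply (mulV_hat _ _ _ _ _ _ Ea Eb), eqV_refl.
    + apply (mulV_hat _ _ _ _ _ _ Ec Ed), eqV_refl.
    + exists (a0 * b0), (c0 * d0). auto using eqV_refl.
Qed.

(** * Rational numbers *)

Local Open Scope R_scope.

Definition frac (a b c : nat) : R := (INR a - INR b) / INR c.
Definition rational (r : R) : Prop := exists a b c, (0 < c)%nat /\ r = frac a b c.

Lemma INR_pos c : (0 < c)%nat -> 0 < INR c.
Proof. apply lt_0_INR. Qed.

Lemma frac_eq_nat a b c a' b' c' : (0 < c)%nat -> (0 < c')%nat ->
  frac a b c = frac a' b' c' <-> (a * c' + b' * c = a' * c + b * c')%nat.
Proof.
  intros Hc Hc'. apply INR_pos in Hc as Pc, Hc' as Pc'. unfold frac. split.
  - intros E. apply INR_eq. rewrite !plus_INR, !mult_INR.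
    assert (K : (INR a - INR b) * INR c' = (INR a' - INR b') * INR c).
    { apply (f_equal (fun t => t * INR c * INR c')) in E. field_simplify in E; lra. }
    lra.
  - intros E. apply (f_equal INR) in E. rewrite !plus_INR, !mult_INR in E.
    apply Rmult_eq_reg_r with (INR c * INR c'); [|nra]. field_simplify; lra.
Qed.

Lemma frac_lt_nat a b c a' b' c' : (0 < c)%nat -> (0 < c')%nat ->
  frac a b c < frac a' b' c' <-> (a * c' + b' * c < a' * c + b * c')%nat.
Proof.
  intros Hc Hc'. apply INR_pos in Hc as Pc, Hc' as Pc'. unfold frac.
  assert (K : forall u v, u / INR c < v / INR c' <-> u * INR c' < v * INR c).
  { intros u v. split; intros E.
    - apply (Rmult_lt_compat_r (INR c * INR c')) in E; [|nra]. field_simplify in E; lra.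
    - apply (Rmult_lt_reg_r (INR c * INR c')); [nra|]. field_simplify; lra. }
  rewrite K. split; intros E.
  - apply INR_lt. rewrite !plus_INR, !mult_INR. lra.
  - apply lt_INR in E. rewrite !plus_INR, !mult_INR in E. lra.
Qed.

Lemma frac_add a b c a' b' c' : (0 < c)%nat -> (0 < c')%nat ->
  frac a b c + frac a' b' c' = frac (a * c' + a' * c) (b * c' + b' * c) (c * c').
Proof.
  intros Hc Hc'. apply INR_pos in Hc, Hc'. unfold frac.
  rewrite !plus_INR, !mult_INR. field. lra.
Qed.

Lemma rational_frac a b c : (0 < c)%nat -> rational (frac a b c).
Proof. intros. now exists a, b, c. Qed.
Lemma rational_add r s : rational r -> rational s -> rational (r + s).
Proof.
  intros (a & b & c & Hc & ->) (a' & b' & c' & Hc' & ->).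
  rewrite frac_add by auto. apply rational_frac. now apply Nat.mul_pos_pos.
Qed.
Lemma rational_opp r : rational r -> rational (- r).
Proof.
  intros (a & b & c & Hc & ->). exists b, a, c. split; auto. apply INR_pos in Hc.
  unfold frac. field. lra.
Qed.
Lemma rational_dist r s : rational r -> rational s -> rational (Rabs (r - s)).
Proof.
  intros Hr Hs. assert (K : rational (r - s)).
  { apply rational_add; auto using rational_opp. }
  unfold Rabs. destruct Rcase_abs; auto using rational_opp.
Qed.
Lemma frac_inv m : frac 1 0 m = / INR m.
Proof. unfold frac. simpl. rewrite Rminus_0_r. apply Rmult_1_l. Qed.
Lemma rational_inv m : (0 < m)%nat -> rational (/ INR m).
Proof. intros. rewrite <- frac_inv. now apply rational_frac. Qed.
Lemma rational_0 : rational 0.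
Proof. exists 0%nat, 0%nat, 1%nat. split; [lia|]. unfold frac. simpl. field. Qed.

(** The set of all fractions with value [r]: it is the equivalence class that
    represents [r] if [r] is rational, and empty otherwise. *)
Definition ratV (r : R) : V :=
  mk (nat * nat * nat)
     (fun t => pairV (pairV (hat (fst (fst t))) (hat (snd (fst t)))) (hat (snd t)))
     (fun t _ => (0 < snd t)%nat /\ frac (fst (fst t)) (snd (fst t)) (snd t) = r).

Lemma mem_ratV t r x : memV t (ratV r) x <->
  exists a b c, (0 < c)%nat /\ frac a b c = r /\
                eqV t (pairV (pairV (hat a) (hat b)) (hat c)) x.
Proof.
  split.
  - intros ([[a b] c] & H & E). apply box_elim in H. simpl in *. exists a, b, c. tauto.
  - intros (a & b & c & Hc & Hr & E). exists (a, b, c). split; auto.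
    now apply box_all.
Qed.

Lemma ratV_inj r s x : rational r -> eqV (ratV r) (ratV s) x -> r = s.
Proof.
  intros (a & b & c & Hc & Hr) E.
  assert (M : memV (pairV (pairV (hat a) (hat b)) (hat c)) (ratV s) x).
  { eapply memV_r; [exact E|]. apply mem_ratV. exists a, b, c. auto using eqV_refl. }
  apply mem_ratV in M as (a' & b' & c' & Hc' & Hs & M).
  apply pairV_inj in M as [M Mc]. apply pairV_inj in M as [Ma Mb].
  apply hat_inj in Ma, Mb, Mc. subst. reflexivity.
Qed.

Definition ratD : discrete :=
  Disc R rational ratV (fun r s x H _ => ratV_inj r s x H).
Definition posratD : discrete :=
  Disc R (fun r => rational r /\ 0 < r) ratV (fun r s x H _ => ratV_inj r s x (proj1 H)).

Definition fracV (a b c t : V) (x : pt) : Prop :=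
  exists a0 b0 c0, eqV a (hat a0) x /\ eqV b (hat b0) x /\ eqV c (hat c0) x /\
    (0 < c0)%nat /\ eqV t (pairV (pairV (hat a0) (hat b0)) (hat c0)) x.

Lemma means_is_frac d e a b c t va vb vc vt :
  den d e a va -> den d e b vb -> den d e c vc -> den d e t vt ->
  means d e (is_frac a b c t) (fracV va vb vc vt).
Proof.
  by_meaning is_frac. split.
  - intros ((a0 & _ & Ea) & (b0 & _ & Eb) & (c0 & Hc & Ec) & u & Eu & Et).
    exists a0, b0, c0. repeat split; auto. eapply eqV_trans; [exact Et|].
    apply pairV_congr; auto. eapply eqV_trans; [exact Eu|]. now apply pairV_congr.
  - intros (a0 & b0 & c0 & Ea & Eb & Ec & Hc & Et). split; [now exists a0|].
    split; [now exists b0|]. split; [now exists c0|].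
    exists (pairV va vb). split; [apply eqV_refl|]. eapply eqV_trans; [exact Et|].
    repeat apply pairV_congr; now apply eqV_sym.
Qed.
Hint Extern 1 (means _ _ (is_frac _ _ _ _) _) => rapply means_is_frac : means.

Definition fracEqV (a b c a' b' c' : V) (x : pt) : Prop :=
  exists s, mulAddV a c' b' c s x /\ mulAddV a' c b c' s x.
Definition fracLtV (a b c a' b' c' : V) (x : pt) : Prop :=
  exists s t, mulAddV a c' b' c s x /\ mulAddV a' c b c' t x /\ memV s t x.

Lemma means_frac_eq d e a b c a' b' c' va vb vc va' vb' vc' :
  den d e a va -> den d e b vb -> den d e c vc ->
  den d e a' va' -> den d e b' vb' -> den d e c' vc' ->
  means d e (frac_eq a b c a' b' c') (fracEqV va vb vc va' vb' vc').
Proof. by_meaning frac_eq. reflexivity. Qed.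
Lemma means_frac_lt d e a b c a' b' c' va vb vc va' vb' vc' :
  den d e a va -> den d e b vb -> den d e c vc ->
  den d e a' va' -> den d e b' vb' -> den d e c' vc' ->
  means d e (frac_lt a b c a' b' c') (fracLtV va vb vc va' vb' vc').
Proof. by_meaning frac_lt. reflexivity. Qed.
Hint Extern 1 (means _ _ (frac_eq _ _ _ _ _ _) _) => rapply means_frac_eq : means.
Hint Extern 1 (means _ _ (frac_lt _ _ _ _ _ _) _) => rapply means_frac_lt : means.

Section Frac.
Variables (a b c a' b' c' : V) (a0 b0 c0 a1 b1 c1 : nat) (x : pt).
Hypotheses (Ea : eqV a (hat a0) x) (Eb : eqV b (hat b0) x) (Ec : eqV c (hat c0) x)
  (Ea' : eqV a' (hat a1) x) (Eb' : eqV b' (hat b1) x) (Ec' : eqV c' (hat c1) x)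
  (Pc : (0 < c0)%nat) (Pc' : (0 < c1)%nat).

Lemma fracEqV_hat : fracEqV a b c a' b' c' x <-> frac a0 b0 c0 = frac a1 b1 c1.
Proof.
  rewrite frac_eq_nat by auto. split.
  - intros (s & H & K).
    apply (mulAddV_hat _ a0 _ c1 _ b1 _ c0) in H; auto.
    apply (mulAddV_hat _ a1 _ c0 _ b0 _ c1) in K; auto.
    apply (hat_inj _ _ x). eapply eqV_trans; [apply eqV_sym|]; eauto.
  - intros E. exists (hat (a0 * c1 + b1 * c0)). split.
    + apply (mulAddV_hat _ a0 _ c1 _ b1 _ c0); auto using eqV_refl.
    + rewrite E. apply (mulAddV_hat _ a1 _ c0 _ b0 _ c1); auto using eqV_refl.
Qed.

Lemma fracLtV_hat : fracLtV a b c a' b' c' x <-> frac a0 b0 c0 < frac a1 b1 c1.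
Proof.
  rewrite frac_lt_nat by auto. split.
  - intros (s & t & H & K & M).
    apply (mulAddV_hat _ a0 _ c1 _ b1 _ c0) in H; auto.
    apply (mulAddV_hat _ a1 _ c0 _ b0 _ c1) in K; auto.
    apply (mem_hat_hat _ _ x). eapply memV_r; [exact K|]. eapply memV_l; eauto.
  - intros L. exists (hat (a0 * c1 + b1 * c0)), (hat (a1 * c0 + b0 * c1)). split; [|split].
    + apply (mulAddV_hat _ a0 _ c1 _ b1 _ c0); auto using eqV_refl.
    + apply (mulAddV_hat _ a1 _ c0 _ b0 _ c1); auto using eqV_refl.
    + now apply mem_hat_hat.
Qed.
End Frac.

Definition ratOfV (a b c q : V) (x : pt) : Prop :=
  exists a0 b0 c0, (0 < c0)%nat /\ eqV a (hat a0) x /\ eqV b (hat b0) x /\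
    eqV c (hat c0) x /\ eqV q (ratV (frac a0 b0 c0)) x.

(** [frac_eq] was computed for numerals only, and the entries [a], [b], [c] are
    numerals only near the point; therefore the class is compared with [ratV] on a
    neighbourhood. *)
Lemma means_rat_of d e a b c q va vb vc vq :
  den d e a va -> den d e b vb -> den d e c vc -> den d e q vq ->
  means d e (rat_of a b c q) (ratOfV va vb vc vq).
Proof.
  by_meaning rat_of.
  assert (K : forall a0 b0 c0, (0 < c0)%nat ->
    eqV va (hat a0) z -> eqV vb (hat b0) z -> eqV vc (hat c0) z ->
    box (fun y => forall t, memV t (ratV (frac a0 b0 c0)) y <->
      exists a1 b1 c1, fracV a1 b1 c1 t y /\ fracEqV va vb vc a1 b1 c1 y) z).
  { intros a0 b0 c0 Hc Ea Eb Ec.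
    apply (box3 _ _ _ _ _ (eqV_box _ _ _ Ea) (eqV_box _ _ _ Eb) (eqV_box _ _ _ Ec)).
    clear Ea Eb Ec. intros y Ea Eb Ec t. apply box_elim in Ea, Eb, Ec.
    rewrite mem_ratV. split.
    - intros (a1 & b1 & c1 & Hc1 & E & Et). exists (hat a1), (hat b1), (hat c1). split.
      + exists a1, b1, c1. auto using eqV_refl.
      + apply (fracEqV_hat _ _ _ _ _ _ a0 b0 c0 a1 b1 c1); auto using eqV_refl.
    - intros (a' & b' & c' & (a1 & b1 & c1 & Ea1 & Eb1 & Ec1 & Hc1 & Et) & E).
      exists a1, b1, c1. repeat split; auto. symmetry.
      now apply (fracEqV_hat _ _ _ _ _ _ a0 b0 c0 a1 b1 c1) in E. }
  split.
  - intros ((a0 & _ & Ea) & (b0 & _ & Eb) & (c0 & Hc & Ec) & E).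
    apply (by_extension _ _ _ _ (K a0 b0 c0 Hc Ea Eb Ec)) in E.
    exists a0, b0, c0. auto.
  - intros (a0 & b0 & c0 & Hc & Ea & Eb & Ec & E).
    split; [now exists a0|]. split; [now exists b0|]. split; [now exists c0|].
    now apply (by_extension _ _ _ _ (K a0 b0 c0 Hc Ea Eb Ec)).
Qed.
Hint Extern 1 (means _ _ (rat_of _ _ _ _) _) => rapply means_rat_of : means.

Lemma ratOfV_eq a b c q r x : (0 < c)%nat -> r = frac a b c -> eqV q (ratV r) x ->
  ratOfV (hat a) (hat b) (hat c) q x.
Proof. intros H -> E. exists a, b, c. auto using eqV_refl. Qed.

Lemma means_is_rat d e q vq : den d e q vq -> means d e (is_rat q) (inD ratD vq).
Proof.
  by_meaning is_rat. split.
  - intros (a & b & c & a0 & b0 & c0 & Hc & _ & _ & _ & E).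
    exists (frac a0 b0 c0). split; auto. now apply rational_frac.
  - intros (r & (a & b & c & Hc & Hr) & E). exists (hat a), (hat b), (hat c).
    eapply ratOfV_eq; eauto.
Qed.
Lemma means1_is_rat d e : means1 d e is_rat (inD ratD).
Proof. apply means1_intro. intros. now apply means_is_rat. Qed.
Hint Extern 1 (means _ _ (is_rat _) _) => rapply means_is_rat : means.
Hint Extern 1 (means1 _ _ is_rat _) => rapply means1_is_rat : means.

Definition ratRel2 (P : R -> R -> Prop) (p q : V) (x : pt) : Prop :=
  exists r s, rational r /\ rational s /\ P r s /\ eqV p (ratV r) x /\ eqV q (ratV s) x.
Definition ratRel3 (P : R -> R -> R -> Prop) (p q t : V) (x : pt) : Prop :=
  exists r s u, rational r /\ rational s /\ rational u /\ P r s u /\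
    eqV p (ratV r) x /\ eqV q (ratV s) x /\ eqV t (ratV u) x.

Lemma means_rat_lt d e p q vp vq : den d e p vp -> den d e q vq ->
  means d e (rat_lt p q) (ratRel2 Rlt vp vq).
Proof.
  by_meaning rat_lt. split.
  - intros (a & b & c & a' & b' & c' & (a0 & b0 & c0 & Hc & Ea & Eb & Ec & Ep) &
      (a1 & b1 & c1 & Hc1 & Ea1 & Eb1 & Ec1 & Eq) & L).
    apply (fracLtV_hat _ _ _ _ _ _ a0 b0 c0 a1 b1 c1) in L; auto.
    exists (frac a0 b0 c0), (frac a1 b1 c1). auto using rational_frac.
  - intros (r & s & (a & b & c & Hc & Hr) & (a' & b' & c' & Hc' & Hs) & L & Ep & Eq).
    exists (hat a), (hat b), (hat c), (hat a'), (hat b'), (hat c').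
    split; [eapply ratOfV_eq; eauto|]. split; [eapply ratOfV_eq; eauto|].
    apply (fracLtV_hat _ _ _ _ _ _ a b c a' b' c'); auto using eqV_refl.
    now rewrite <- Hr, <- Hs.
Qed.
Hint Extern 1 (means _ _ (rat_lt _ _) _) => rapply means_rat_lt : means.

Lemma means_rat_le d e p q vp vq : den d e p vp -> den d e q vq ->
  means d e (rat_le p q) (ratRel2 Rle vp vq).
Proof.
  by_meaning rat_le. split.
  - intros [(r & s & Hr & Hs & L & Ep & Eq)|[(r & Hr & E) Epq]].
    + exists r, s. repeat split; auto. lra.
    + exists r, r. repeat split; auto; [lra|].
      eapply eqV_trans; [apply eqV_sym|]; eauto.
  - intros (r & s & Hr & Hs & [L| ->] & Ep & Eq).
    + left. exists r, s. auto.
    + right. split; [now exists s|]. eapply eqV_trans; [|apply eqV_sym]; eauto.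
Qed.
Hint Extern 1 (means _ _ (rat_le _ _) _) => rapply means_rat_le : means.

Lemma means_rat_add d e p q r vp vq vr : den d e p vp -> den d e q vq -> den d e r vr ->
  means d e (rat_add p q r) (ratRel3 (fun r s u => u = r + s) vp vq vr).
Proof.
  by_meaning rat_add. split.
  - intros (a & b & c & a' & b' & c' & (a0 & b0 & c0 & Hc & Ea & Eb & Ec & Ep) &
      (a1 & b1 & c1 & Hc1 & Ea1 & Eb1 & Ec1 & Eq) &
      s & t & u & Hs & Ht & Hu & (a2 & b2 & c2 & Hc2 & Es & Et & Eu & Er)).
    apply (mulAddV_hat _ a0 _ c1 _ a1 _ c0) in Hs; auto.
    apply (mulAddV_hat _ b0 _ c1 _ b1 _ c0) in Ht; auto.
    apply (mulV_hat _ c0 _ c1) in Hu; auto.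
    exists (frac a0 b0 c0), (frac a1 b1 c1), (frac a2 b2 c2).
    repeat split; auto using rational_frac.
    rewrite frac_add by auto.
    f_equal; apply (hat_inj _ _ z); (eapply eqV_trans; [apply eqV_sym|]); eauto.
  - intros (r0 & s0 & u0 & (a & b & c & Hc & Hr) & (a' & b' & c' & Hc' & Hs) & _ & Hu &
      Ep & Eq & Er).
    exists (hat a), (hat b), (hat c), (hat a'), (hat b'), (hat c').
    split; [eapply ratOfV_eq; eauto|]. split; [eapply ratOfV_eq; eauto|].
    exists (hat (a * c' + a' * c)), (hat (b * c' + b' * c)), (hat (c * c')).
    split; [apply (mulAddV_hat _ a _ c' _ a' _ c); apply eqV_refl|].
    split; [apply (mulAddV_hat _ b _ c' _ b' _ c); apply eqV_refl|].
    split; [apply (mulV_hat _ c _ c'); apply eqV_refl|].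
    eapply ratOfV_eq; [now apply Nat.mul_pos_pos| |exact Er].
    rewrite Hu, Hr, Hs. now apply frac_add.
Qed.
Hint Extern 1 (means _ _ (rat_add _ _ _) _) => rapply means_rat_add : means.

Lemma ratV_eq r s v x : rational r -> eqV v (ratV r) x -> eqV v (ratV s) x -> r = s.
Proof.
  intros Hr E E'. apply (ratV_inj r s x Hr). eapply eqV_trans; [apply eqV_sym|]; eauto.
Qed.

Lemma means_rat_dist d e p q r vp vq vr : den d e p vp -> den d e q vq -> den d e r vr ->
  means d e (rat_dist p q r) (ratRel3 (fun r s u => u = Rabs (r - s)) vp vq vr).
Proof.
  by_meaning rat_dist. split.
  - intros [[(a & b & Ha & Hb & L & Ep & Eq) (a' & u & b' & Ha' & Hu & Hb' & E & Ep' & Er & Eq')]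
           |[(b & a & Hb & Ha & L & Eq & Ep) (b' & u & a' & Hb' & Hu & Ha' & E & Eq' & Er & Ep')]];
      apply (ratV_eq a a' _ _ Ha Ep) in Ep'; apply (ratV_eq b b' _ _ Hb Eq) in Eq'; subst.
    + exists a', (a' + u), u. repeat split; auto.
      rewrite Rabs_left1; lra.
    + exists (b' + u), b', u. repeat split; auto.
      rewrite Rabs_right; lra.
  - intros (a & b & u & Ha & Hb & Hu & E & Ep & Eq & Er).
    destruct (Rle_or_lt a b) as [L|L]; [left|right]; split.
    + exists a, b. auto.
    + exists a, u, b. repeat split; auto. rewrite Rabs_left1 in E; lra.
    + exists b, a. repeat split; auto. lra.
    + exists b, u, a. repeat split; auto. rewrite Rabs_right in E; lra.
Qed.
Hint Extern 1 (means _ _ (rat_dist _ _ _) _) => rapply means_rat_dist : means.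

Lemma hat_eq i j v x : eqV v (hat i) x -> eqV v (hat j) x -> i = j.
Proof. intros E E'. apply (hat_inj i j x). eapply eqV_trans; [apply eqV_sym|]; eauto. Qed.

Definition recipV (m r : V) (x : pt) : Prop :=
  exists k, (0 < k)%nat /\ eqV m (hat k) x /\ eqV r (ratV (/ INR k)) x.

Lemma means_rat_recip d e m r vm vr : den d e m vm -> den d e r vr ->
  means d e (rat_recip m r) (recipV vm vr).
Proof.
  by_meaning rat_recip. split.
  - intros (o & Eo & a & b & c & Hc & Ea & Eb & Ec & Er).
    apply (hat_eq 1 a) in Ea as <-; auto. apply (hat_inj 0) in Eb as <-.
    exists c. rewrite <- frac_inv. auto.
  - intros (k & Hk & Ek & Er). exists (hat 1). split; [apply eqV_refl|].
    exists 1%nat, 0%nat, k. rewrite frac_inv. auto using eqV_refl.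
Qed.
Hint Extern 1 (means _ _ (rat_recip _ _) _) => rapply means_rat_recip : means.

Lemma frac_zero : frac 0 0 1 = 0.
Proof. unfold frac. simpl. field. Qed.

Lemma means1_is_rat_zero d e : means1 d e is_rat_zero (fun v => eqV v (ratV 0)).
Proof.
  apply means1_intro. intros d' e' _ r vr Hr. by_meaning is_rat_zero. split.
  - intros (o & Eo & a & b & c & Hc & Ea & Eb & Ec & Er).
    apply (hat_inj 0) in Ea as <-. apply (hat_inj 0) in Eb as <-.
    apply (hat_eq 1 c) in Ec as <-; auto. now rewrite frac_zero in Er.
  - intros E. exists (hat 1). split; [apply eqV_refl|]. exists 0%nat, 0%nat, 1%nat. rewrite frac_zero. auto using eqV_refl.
Qed.
Hint Extern 1 (means1 _ _ is_rat_zero _) => rapply means1_is_rat_zero : means.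

Lemma means1_is_posrat d e : means1 d e is_posrat (inD posratD).
Proof.
  apply means1_intro. intros d' e' _ r vr Hr. by_meaning is_posrat. split.
  - intros (a & b & Ha & Hb & L & Ea & Eb). exists b. split; auto. split; auto.
    apply (ratV_inj 0 a z rational_0) in Ea. lra.
  - intros (r' & [Hr1 Hr2] & E). exists 0, r'. auto using rational_0, eqV_refl.
Qed.
Hint Extern 1 (means1 _ _ is_posrat _) => rapply means1_is_posrat : means.

Definition ratAt (X n : V) (r : R) (x : pt) : Prop := memV (pairV n (ratV r)) X x.

Definition nearV (X n Y m e : V) (x : pt) : Prop :=
  exists r s u, rational r /\ rational s /\ rational u /\
    ratAt X n r x /\ ratAt Y m s x /\ eqV e (ratV u) x /\ Rabs (r - s) < u.

Lemma memV_pair_r n a b X x : eqV a b x -> memV (pairV n a) X x -> memV (pairV n b) X x.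
Proof. intros E. apply memV_l, pairV_congr; auto using eqV_refl. Qed.

Lemma means_near d l X n Y m e vX vn vY vm ve : den d l X vX -> den d l n vn ->
  den d l Y vY -> den d l m vm -> den d l e ve ->
  means d l (near X n Y m e) (nearV vX vn vY vm ve).
Proof.
  by_meaning near. split.
  - intros (p & q & r & Hp & Hq & (a & b & u & Ha & Hb & Hu & E & Ep & Eq & Er) &
      (u' & w & Hu' & Hw & L & Er' & Ew)).
    apply (ratV_eq u u' _ _ Hu Er) in Er'. subst.
    exists a, b, w. repeat split; auto; eapply memV_pair_r; eauto.
  - intros (r & s & u & Hr & Hs & Hu & HX & HY & E & L).
    exists (ratV r), (ratV s), (ratV (Rabs (r - s))). split; auto. split; auto. split.
    + exists r, s, (Rabs (r - s)). auto 10 using rational_dist, eqV_refl.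
    + exists (Rabs (r - s)), u. auto using rational_dist, eqV_refl.
Qed.
Hint Extern 1 (means _ _ (near _ _ _ _ _) _) => rapply means_near : means.

(** * Sequences with a modulus of convergence *)

Lemma means_is_ratseq d e X vX : den d e X vX -> means d e (is_ratseq X) (funD natD ratD vX).
Proof. by_meaning is_ratseq. reflexivity. Qed.
Hint Extern 1 (means _ _ (is_ratseq _) _) => rapply means_is_ratseq : means.

Lemma funD_box D1 D2 f x : funD D1 D2 f x -> box (funD D1 D2 f) x.
Proof. apply box_box. Qed.

Lemma funD_total D1 D2 f x i : funD D1 D2 f x -> allowed D1 i ->
  exists j, allowed D2 j /\ memV (pairV (name_of D1 i) (name_of D2 j)) f x.
Proof.
  intros H Hi. apply box_elim in H. destruct H as [_ H].
  destruct (H i Hi) as (j & Hj & M & _). eauto.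
Qed.

Lemma funD_unique D1 D2 f x i j j' : funD D1 D2 f x -> allowed D1 i -> allowed D2 j -> allowed D2 j' ->
  memV (pairV (name_of D1 i) (name_of D2 j)) f x -> memV (pairV (name_of D1 i) (name_of D2 j')) f x -> j = j'.
Proof.
  intros H Hi Hj Hj' M M'. apply box_elim in H. destruct H as [_ H].
  destruct (H i Hi) as (j0 & _ & _ & U). rewrite (U j), (U j'); auto.
Qed.

Lemma funD_congr D1 D2 f g x : eqV f g x -> funD D1 D2 f x -> funD D1 D2 g x.
Proof.
  intros E H. apply (box2 _ _ _ _ (eqV_box _ _ _ E) H). clear E H x.
  intros y E H. apply box_elim in E, H. pose proof (eqV_sym _ _ _ E) as E'.
  destruct H as [H1 H2]. split.
  - intros p Hp. apply H1. eapply memV_r; eauto.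
  - intros i Hi. destruct (H2 i Hi) as (j & Hj & M & U). exists j. repeat split; auto.
    + eapply memV_r; eauto.
    + intros j' Hj' M'. apply U; auto. eapply memV_r; eauto.
Qed.

(** [q] is the [k]-th term of [X] at the point [x].  In this way the sequence [X]
    has, at each point, an ordinary sequence of rationals as its value. *)
Definition val (X : V) (k : nat) (q : R) (x : pt) : Prop :=
  rational q /\ ratAt X (hat k) q x.

Lemma val_total X k x : funD natD ratD X x -> exists q, val X k q x.
Proof. intros H. destruct (funD_total natD ratD X x k H I) as (q & Hq & M). now exists q. Qed.

Lemma val_unique X k x q q' : funD natD ratD X x -> val X k q x -> val X k q' x -> q = q'.
Proof. intros H [Hq M] [Hq' M']. exact (funD_unique natD ratD X x k q q' H I Hq Hq' M M'). Qed.

Lemma val_congr X Y k q x : eqV X Y x -> val X k q x -> val Y k q x.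
Proof. intros E [Hq M]. split; auto. eapply memV_r; eauto. Qed.

Lemma val_box X k q x : val X k q x -> box (val X k q) x.
Proof. intros [Hq M]. apply memV_box in M. revert M. apply box_mono. now split. Qed.

Lemma nearV_val X n Y m u x :
  rational u -> nearV X (hat n) Y (hat m) (ratV u) x <->
  exists r s, val X n r x /\ val Y m s x /\ Rabs (r - s) < u.
Proof.
  intros Hu. split.
  - intros (r & s & u' & Hr & Hs & Hu' & MX & MY & E & L).
    apply (ratV_inj u u' x Hu) in E. subst. exists r, s. unfold val. auto.
  - intros (r & s & [Hr MX] & [Hs MY] & L). exists r, s, u. auto 10 using eqV_refl.
Qed.

(** The pointwise content of [is_seqmod_of]: a modulus makes the sequence
    Cauchy, so only the modulus condition appears. *)
Definition modulated (X f : V) (x : pt) : Prop :=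
  funD natD ratD X x /\ funD posratD natD f x /\
  forall u K, rational u -> 0 < u -> memV (pairV (ratV u) (hat K)) f x ->
    forall m n r s, (K < m)%nat -> (K < n)%nat -> val X m r x -> val X n s x ->
      Rabs (r - s) < u.

(** Truth of the modulus condition on a neighbourhood is what remains of the
    nested quantifiers, which all speak of constant numbers. *)
Definition seqmodV (X f s : V) (x : pt) : Prop :=
  eqV s (pairV X f) x /\ box (modulated X f) x.

(** Values of [f] and [X] at a point persist near it, which is why a condition at
    each point of a neighbourhood suffices. *)
Lemma means_is_seqmod_of d e X f s vX vf vs : den d e X vX -> den d e f vf -> den d e s vs ->
  means d e (is_seqmod_of X f s) (seqmodV vX vf vs).
Proof.
  intros HX Hf Hs.
  eapply means_iff; [unfold is_seqmod_of, is_cauchy, is_modulus; meaning|].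
  intros x. split.
  - intros (E & (HX1 & _) & Hf1 & HM). split; auto.
    apply (box3 _ _ _ _ _ (funD_box _ _ _ _ HX1) (funD_box _ _ _ _ Hf1) HM).
    clear E HX1 Hf1 HM x. intros y HX1 Hf1 HM. apply box_elim in HX1, Hf1, HM.
    split; [auto|split; [auto|]].
    intros u K Hu Pu M m n r s' Hm Hn Hr Hs'.
    pose proof (box_elim _ _ (HM u (conj Hu Pu)) (hat K)) as K1.
    pose proof (box_elim _ _ K1 M) as K2.
    pose proof (box_elim _ _ (box_elim _ _ K2 n I) m I) as K3.
    pose proof (box_elim _ _ K3 (proj2 (mem_hat_hat _ _ _) Hn)) as K4.
    pose proof (box_elim _ _ K4 (proj2 (mem_hat_hat _ _ _) Hm)) as K5.
    apply nearV_val in K5 as (r' & s'' & Hr' & Hs'' & L); auto.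
    now rewrite (val_unique _ _ _ _ _ HX1 Hr Hr'), (val_unique _ _ _ _ _ HX1 Hs' Hs'').
  - intros (E & H). split; auto. pose proof (box_elim _ _ H) as (HX1 & Hf1 & _).
    assert (Near : forall y u K m n, box (modulated vX vf) y -> rational u -> 0 < u ->
      memV (pairV (ratV u) (hat K)) vf y -> (K < m)%nat -> (K < n)%nat ->
      nearV vX (hat n) vX (hat m) (ratV u) y).
    { intros y u K m n Hy Hu Pu M Hm Hn. apply box_elim in Hy. destruct Hy as (G1 & G2 & G3).
      apply nearV_val; auto.
      destruct (val_total vX n y G1) as (r & Hr), (val_total vX m y G1) as (s' & Hs').
      exists r, s'. split; [auto|split; [auto|]]. exact (G3 u K Hu Pu M n m r s' Hn Hm Hr Hs'). }
    split; [split; auto|split; auto].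
    + apply (box1 _ _ _ H). clear x E H HX1 Hf1. intros y H u [Hu Pu].
      pose proof (box_elim _ _ H) as (_ & Hf1 & _).
      destruct (funD_total posratD natD vf y u Hf1 (conj Hu Pu)) as (K & _ & M).
      exists K. split; [exact I|]. apply (box2 _ _ _ _ H (memV_box _ _ _ M)).
      clear y H M Hf1. intros y H M m _. apply (box2 _ _ _ _ H M).
      clear y H M. intros y H M n _. apply (box2 _ _ _ _ H M).
      clear y H M. intros y H M Hm. apply mem_hat_hat in Hm. apply (box2 _ _ _ _ H M).
      clear y H M. intros y H M Hn. apply mem_hat_hat in Hn. apply box_elim in M.
      now apply Near with K.
    + apply (box1 _ _ _ H). clear x E H HX1 Hf1. intros y H u [Hu Pu].
      apply (box1 _ _ _ H). clear y H. intros y H v. apply (box1 _ _ _ H).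
      clear y H. intros y H M.
      assert (HK : exists K, eqV v (hat K) y).
      { pose proof (box_elim _ _ H) as (_ & Hf1 & _).
        apply box_elim in Hf1. destruct Hf1 as [F _].
        destruct (F _ M) as (i & K & _ & _ & E). apply pairV_inj in E as [_ E]. eauto. }
      destruct HK as [K E].
      assert (M' : memV (pairV (ratV u) (hat K)) vf y) by (eapply memV_pair_r; eauto).
      clear M. rename M' into M. apply memV_box in M. apply eqV_box in E.
      apply (box3 _ _ _ _ _ H M E). clear y H M E. intros y H M E m _.
      apply (box3 _ _ _ _ _ H M E). clear y H M E. intros y H M E n _.
      apply (box3 _ _ _ _ _ H M E). clear y H M E. intros y H M E Hm.
      apply (memV_l _ _ _ _ (box_elim _ _ E)), mem_hat_hat in Hm.
      apply (box3 _ _ _ _ _ H M E). clear y H M E. intros y H M E Hn.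
      apply (memV_l _ _ _ _ (box_elim _ _ E)), mem_hat_hat in Hn.
      apply box_elim in M. now apply Near with K.
Qed.
Hint Extern 1 (means _ _ (is_seqmod_of _ _ _) _) => rapply means_is_seqmod_of : means.

Definition seqmodP (s : V) (x : pt) : Prop := exists X f, seqmodV X f s x.
Lemma means_is_seqmod d e s vs : den d e s vs -> means d e (is_seqmod s) (seqmodP vs).
Proof. by_meaning is_seqmod. reflexivity. Qed.
Lemma means1_is_seqmod d e : means1 d e is_seqmod seqmodP.
Proof. apply means1_intro. intros. now apply means_is_seqmod. Qed.
Hint Extern 1 (means _ _ (is_seqmod _) _) => rapply means_is_seqmod : means.
Hint Extern 1 (means1 _ _ is_seqmod _) => rapply means1_is_seqmod : means.

Definition equivV (s t : V) (x : pt) : Prop := exists X f Y g,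
  seqmodV X f s x /\ seqmodV Y g t x /\
  box (fun y => forall m, (0 < m)%nat -> exists K, box (fun z => forall k, (K < k)%nat ->
    exists r s, val X k r z /\ val Y k s z /\ Rabs (r - s) < / INR m) y) x.

Lemma means_seqmod_equiv d e s t vs vt : den d e s vs -> den d e t vt ->
  means d e (seqmod_equiv s t) (equivV vs vt).
Proof.
  intros Hs Ht. eapply means_iff; [unfold seqmod_equiv; meaning|intros z].
  split; intros (X & f & Y & g & H1 & H2 & H); exists X, f, Y, g;
    (split; [exact H1|]); (split; [exact H2|]); clear H1 H2; apply (box1 _ _ _ H); clear H; intros y H m Hm;
    destruct (box_elim _ _ H m Hm) as (K & HK); clear H.
  - destruct HK as [_ HK]. exists K. apply (box1 _ _ _ HK). clear y HK. intros y HK k Hk.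
    apply box_elim in HK.
    destruct (box_elim _ _ (HK k I) (proj2 (mem_hat_hat _ _ _) Hk)) as (r & (m' & Hm' & E & Er) & Hn).
    apply hat_inj in E. subst m'.
    destruct Hn as (a & b & u & Ha & Hb & Hu & Ma & Mb & Eu & L).
    assert (/ INR m = u) as ->.
    { apply (ratV_eq _ _ _ _ (rational_inv m Hm) Er Eu). }
    exists a, b. unfold val. auto.
  - exists K. split; [exact I|]. apply (box1 _ _ _ HK). clear y HK. intros y HK k _.
    apply (box1 _ _ _ HK). clear y HK. intros y HK Hk. apply mem_hat_hat in Hk.
    apply box_elim in HK. exists (ratV (/ INR m)). split.
    + exists m. auto using eqV_refl.
    + apply nearV_val; auto using rational_inv.
Qed.
Hint Extern 1 (means _ _ (seqmod_equiv _ _) _) => rapply means_seqmod_equiv : means.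

(** Convergence of the value of [X] at [x]; the limit [r] is a real number of the
    metatheory. *)
Definition conv (X : V) (r : R) (x : pt) : Prop := forall eps, 0 < eps ->
  exists K, forall k q, (K < k)%nat -> val X k q x -> Rabs (q - r) < eps.

Lemma conv_congr X Y r x : eqV X Y x -> conv X r x -> conv Y r x.
Proof.
  intros E H eps P. destruct (H eps P) as [K HK]. exists K. intros k q Hk Hq.
  apply HK with k; auto. eapply val_congr; [apply eqV_sym|]; eauto.
Qed.

Lemma inv_small eps : 0 < eps -> exists m, (0 < m)%nat /\ / INR m < eps.
Proof.
  intros H. destruct (archimed_cor1 eps H) as (m & L & Hm). exists m. split; auto; lra.
Qed.

Lemma conv_unique X r r' x : funD natD ratD X x -> conv X r x -> conv X r' x -> r = r'.
Proof.
  intros HX H H'. apply cond_eq. intros eps P.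
  destruct (H (eps / 2)) as [K HK]; [lra|]. destruct (H' (eps / 2)) as [K' HK']; [lra|].
  destruct (val_total X (S (max K K')) x HX) as [q Hq].
  specialize (HK (S (max K K')) q ltac:(lia) Hq).
  specialize (HK' (S (max K K')) q ltac:(lia) Hq).
  apply Rabs_def2 in HK, HK'. apply Rabs_def1; lra.
Qed.

Lemma modulated_small X f x eps : modulated X f x -> 0 < eps ->
  exists u K, rational u /\ 0 < u < eps /\ memV (pairV (ratV u) (hat K)) f x.
Proof.
  intros (_ & Hf & _) P. destruct (inv_small eps P) as (m & Hm & L).
  assert (P' : 0 < / INR m) by now apply Rinv_0_lt_compat, INR_pos.
  destruct (funD_total posratD natD f x (/ INR m) Hf) as (K & _ & M).
  { split; auto using rational_inv. }
  exists (/ INR m), K. auto using rational_inv.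
Qed.

Lemma modulated_conv X f x : modulated X f x -> exists r, conv X r x.
Proof.
  intros H. pose proof H as (HX & _ & HM).
  destruct (choice (fun k q => val X k q x)) as [u Hu].
  { intros k. now apply val_total. }
  destruct (R_complete u) as [r Hr].
  - intros eps P. destruct (modulated_small _ _ _ _ H P) as (v & K & Hv & Pv & M).
    exists (S K). intros m n Hm Hn. unfold R_dist.
    apply Rlt_trans with v; [|lra]. apply (HM v K Hv (proj1 Pv) M m n); auto; lia.
  - exists r. intros eps P. destruct (Hr eps P) as [K HK]. exists K. intros k q Hk Hq.
    rewrite (val_unique X k x q (u k)); auto. apply HK. lia.
Qed.

(** With a modulus, closeness to the limit at a point is uniform over the
    points where the modulus takes the same value. *)
Lemma modulated_rate X f x r u K k q : modulated X f x -> conv X r x ->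
  rational u -> 0 < u -> memV (pairV (ratV u) (hat K)) f x -> (K < k)%nat -> val X k q x ->
  Rabs (q - r) <= u.
Proof.
  intros (HX & _ & HM) C Hu Pu M Hk Hq. apply Rnot_lt_le. intros L.
  destruct (C (Rabs (q - r) - u)) as [K' HK']; [lra|].
  destruct (val_total X (S (max K K')) x HX) as [q' Hq'].
  specialize (HK' (S (max K K')) q' ltac:(lia) Hq').
  assert (L' : Rabs (q - q') < u) by (apply (HM u K Hu Pu M k (S (max K K'))); auto; lia).
  pose proof (Rabs_triang (q - q') (q' - r)) as T.
  replace (q - q' + (q' - r)) with (q - r) in T by ring. lra.
Qed.

(** The pair [t] denotes the real number [r] at the point [x]. *)
Definition repr (t : V) (r : R) (x : pt) : Prop :=
  exists X f, seqmodV X f t x /\ conv X r x.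

Lemma seqmodV_eq X f X' f' t x : seqmodV X f t x -> seqmodV X' f' t x ->
  eqV X X' x /\ eqV f f' x.
Proof.
  intros [E _] [E' _]. apply pairV_inj. eapply eqV_trans; [apply eqV_sym|]; eauto.
Qed.

Lemma repr_conv X f t r x : seqmodV X f t x -> repr t r x -> conv X r x.
Proof.
  intros H (X' & f' & H' & C). destruct (seqmodV_eq _ _ _ _ _ _ H' H) as [E _].
  eapply conv_congr; eauto.
Qed.

Lemma repr_exists t x : seqmodP t x -> exists r, repr t r x.
Proof.
  intros (X & f & H). destruct (modulated_conv X f x) as [r C].
  { apply box_elim, H. }
  exists r, X, f. auto.
Qed.

Lemma repr_seqmod t r x : repr t r x -> seqmodP t x.
Proof. intros (X & f & H & _). now exists X, f. Qed.

Lemma repr_unique t r r' x : repr t r x -> repr t r' x -> r = r'.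
Proof.
  intros (X & f & H & C) H'. apply (repr_conv _ _ _ _ _ H) in H'.
  apply (conv_unique X r r' x); auto. destruct H as [_ H]. apply box_elim in H. apply H.
Qed.

Lemma repr_congr t t' r x : eqV t t' x -> repr t r x -> repr t' r x.
Proof.
  intros E (X & f & [H1 H2] & C). exists X, f. repeat split; auto.
  eapply eqV_trans; [apply eqV_sym|]; eauto.
Qed.

Lemma seqmodV_box X f t x : seqmodV X f t x -> box (seqmodV X f t) x.
Proof. intros [E B]. apply box_and; [now apply eqV_box|now apply box_box]. Qed.

Lemma equivV_box s t x : equivV s t x -> box (equivV s t) x.
Proof.
  intros (X & f & Y & g & Hs & Ht & H).
  apply (box3 _ _ _ _ _ (seqmodV_box _ _ _ _ Hs) (seqmodV_box _ _ _ _ Ht) H).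
  intros y Hs' Ht' H'. exists X, f, Y, g.
  split; [exact (box_elim _ _ Hs')|split; [exact (box_elim _ _ Ht')|exact H']].
Qed.

(** Equivalent pairs have the same limit at each point. *)
Lemma equivV_repr s t r x : equivV s t x -> repr s r x -> repr t r x.
Proof.
  intros (X & f & Y & g & Hs & Ht & H) HC. apply (repr_conv _ _ _ _ _ Hs) in HC.
  exists Y, g. split; auto. intros eps P. destruct (inv_small (eps / 2)) as (m & Hm & L); [lra|].
  destruct (box_elim _ _ H m Hm) as [K HK]. apply box_elim in HK.
  destruct (HC (eps / 2)) as [K' HK']; [lra|].
  exists (max K K'). intros k q Hk Hq. destruct (HK k) as (a & b & Ha & Hb & D); [lia|].
  assert (G : funD natD ratD Y x) by apply (box_elim _ _ (proj2 Ht)).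
  rewrite (val_unique _ _ _ _ _ G Hq Hb). specialize (HK' k a ltac:(lia) Ha).
  apply Rabs_def2 in HK', D. apply Rabs_def1; lra.
Qed.

(** Equality of the limits at all points of a neighbourhood gives equivalence.
    The index from which the sequences are close is needed on a whole
    neighbourhood: it is read off the moduli, whose values are locally constant,
    by [modulated_rate]. *)
Lemma equivV_of_repr s t x : box (fun y => exists r, repr s r y /\ repr t r y) x ->
  equivV s t x.
Proof.
  intros H. pose proof (box_elim _ _ H) as (r & (X & f & Hs & _) & (Y & g & Ht & _)).
  exists X, f, Y, g. split; [auto|split; [auto|]].
  pose proof (seqmodV_box _ _ _ _ Hs) as Hs'. pose proof (seqmodV_box _ _ _ _ Ht) as Ht'.
  clear r Hs Ht. apply (box3 _ _ _ _ _ H Hs' Ht'). clear x H Hs' Ht'.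
  intros y H Hs Ht m Hm.
  assert (P : 0 < / INR m) by now apply Rinv_0_lt_compat, INR_pos.
  destruct (modulated_small X f y (/ INR m / 2)) as (u & K & Hu & Pu & M); [|lra|].
  { apply box_elim, (box_elim _ _ Hs). }
  destruct (modulated_small Y g y (/ INR m / 2)) as (v & L & Hv & Pv & M'); [|lra|].
  { apply box_elim, (box_elim _ _ Ht). }
  exists (max K L).
  apply (box3 _ _ _ _ _ (box_and _ _ _ Hs Ht) H (box_and _ _ _ (memV_box _ _ _ M) (memV_box _ _ _ M'))).
  clear y Hs Ht H M M'. intros y Hst H M k Hk. apply box_elim in Hst, M, H.
  destruct Hst as [Hs Ht], M as [M M'], H as (r & HX & HY).
  apply (repr_conv _ _ _ _ _ Hs) in HX. apply (repr_conv _ _ _ _ _ Ht) in HY.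
  destruct Hs as [_ Hs], Ht as [_ Ht]. apply box_elim in Hs, Ht.
  destruct (val_total X k y) as [a Ha]; [apply Hs|].
  destruct (val_total Y k y) as [b Hb]; [apply Ht|].
  exists a, b. split; [auto|split; [auto|]].
  assert (D : Rabs (a - r) <= u) by (apply (modulated_rate X f y r u K k); auto; lra || lia).
  assert (D' : Rabs (b - r) <= v) by (apply (modulated_rate Y g y r v L k); auto; lra || lia).
  pose proof (Rabs_triang (a - r) (r - b)) as T. rewrite (Rabs_minus_sym r b) in T.
  replace (a - r + (r - b)) with (a - b) in T by ring. lra.
Qed.

(** * Reals and limits *)

(** The real with value [G y] at [y], as the set of all pairs that represent
    [G]: up to equality, such a pair is given by the truth values of the entries
    of its two functions ([funV_of]), which makes the set of indices small. *)
Definition realV (G : pt -> R) : V :=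
  mk ((nat -> R -> pt -> Prop) * (R -> nat -> pt -> Prop))
     (fun p => pairV (funV natD ratD (fst p)) (funV posratD natD (snd p)))
     (fun p y => repr (pairV (funV natD ratD (fst p)) (funV posratD natD (snd p))) (G y) y).

Lemma mem_realV t G x : memV t (realV G) x <-> box (fun y => repr t (G y) y) x.
Proof.
  split.
  - intros (p & H & E). apply (box2 _ _ _ _ H (eqV_box _ _ _ E)). intros y Hy Ey.
    apply box_elim in Hy, Ey. eapply repr_congr; [apply eqV_sym|]; eauto.
  - intros H. pose proof (box_elim _ _ H) as (X & f & [Et HM] & _).
    pose proof (box_elim _ _ HM) as (HX & Hf & _).
    apply funV_of in HX, Hf.
    exists (fun k q => memV (pairV (hat k) (ratV q)) X,
            fun q k => memV (pairV (ratV q) (hat k)) f).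
    assert (E : eqV t (pairV (funV natD ratD (fun k q => memV (pairV (hat k) (ratV q)) X))
                 (funV posratD natD (fun q k => memV (pairV (ratV q) (hat k)) f))) x).
    { eapply eqV_trans; [exact Et|]. now apply pairV_congr. }
    split; [|exact E]. simpl. apply (box2 _ _ _ _ H (eqV_box _ _ _ E)).
    intros y Hy Ey. apply box_elim in Hy, Ey. eapply repr_congr; eauto.
Qed.

Definition realP (v : V) (x : pt) : Prop := exists s, seqmodP s x /\
  box (fun y => forall t, memV t v y <-> (seqmodP t y /\ equivV s t y)) x.

Lemma box_all_iff (P Q : V -> pt -> Prop) x :
  box (fun y => forall a, box (fun z => P a z -> Q a z) y /\
                          box (fun z => Q a z -> P a z) y) x <->
  box (fun y => forall a, P a y <-> Q a y) x.
Proof.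
  split; intros H; apply (box1 _ _ _ H); intros y Hy a.
  - apply box_elim in Hy. destruct (Hy a) as [H1 H2]. apply box_elim in H1, H2. now split.
  - split; revert Hy; apply box_mono; intros z Hz; apply Hz.
Qed.

Lemma means_is_real d e v vv : den d e v vv -> means d e (is_real v) (realP vv).
Proof.
  intros Hv. eapply means_iff; [unfold is_real; meaning|intros z].
  split; intros (s & Hs & H); exists s; (split; [exact Hs|]); now apply box_all_iff.
Qed.
Lemma means1_is_real d e : means1 d e is_real realP.
Proof. apply means1_intro. intros. now apply means_is_real. Qed.
Hint Extern 1 (means _ _ (is_real _) _) => rapply means_is_real : means.
Hint Extern 1 (means1 _ _ is_real _) => rapply means1_is_real : means.

(** [realV G] is an equivalence class where some pair represents [G]; different
    pairs may be needed at different points. *)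
Lemma realP_realV G x : (exists s, box (fun y => repr s (G y) y) x) -> realP (realV G) x.
Proof.
  intros (s & Hs). exists s. split; [eapply repr_seqmod, (box_elim _ _ Hs)|].
  apply (box1 _ _ _ Hs). clear x Hs. intros y Hs t. rewrite mem_realV. split.
  - intros Ht. split; [eapply repr_seqmod, (box_elim _ _ Ht)|].
    apply equivV_of_repr. apply (box2 _ _ _ _ Hs Ht). intros z Hz Hz'.
    apply box_elim in Hz, Hz'. eauto.
  - intros [_ Ht].
    apply (box2 _ _ _ _ Hs (equivV_box _ _ _ Ht)). intros z Hz Hz'.
    apply box_elim in Hz, Hz'. eapply equivV_repr; eauto.
Qed.

Definition distSeqV (X Y D : V) (x : pt) : Prop := funD natD ratD D x /\
  box (fun y => forall k, exists a b, val X k a y /\ val Y k b y /\ val D k (Rabs (a - b)) y) x.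

Lemma means_is_dist_seq d e X Y D vX vY vD : den d e X vX -> den d e Y vY -> den d e D vD ->
  means d e (is_dist_seq X Y D) (distSeqV vX vY vD).
Proof.
  by_meaning is_dist_seq. split; intros [HD HK]; (split; [exact HD|]);
    revert HK; apply box_mono; intros y HK k.
  - destruct (HK k I) as (p & q & r & Hp & Hq & Hr & a & b & u & Ha & Hb & Hu & E & Ep & Eq & Er).
    subst u. exists a, b. repeat split; auto; eapply memV_pair_r; eauto.
  - intros _. destruct (HK k) as (a & b & [Ha Ma] & [Hb Mb] & [Hc Mc]).
    exists (ratV a), (ratV b), (ratV (Rabs (a - b))). do 3 (split; auto).
    exists a, b, (Rabs (a - b)). auto 10 using eqV_refl.
Qed.
Hint Extern 1 (means _ _ (is_dist_seq _ _ _) _) => rapply means_is_dist_seq : means.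

Definition constSeqV (q C : V) (x : pt) : Prop := funD natD ratD C x /\
  box (fun y => forall k, memV (pairV (hat k) q) C y) x.

Lemma means_is_const_seq d e q C vq vC : den d e q vq -> den d e C vC ->
  means d e (is_const_seq q C) (constSeqV vq vC).
Proof.
  by_meaning is_const_seq. split; intros [HD HK]; (split; [exact HD|]);
    revert HK; apply box_mono; intros y HK k; auto. apply (HK k I).
Qed.
Hint Extern 1 (means _ _ (is_const_seq _ _) _) => rapply means_is_const_seq : means.

Definition seqLtV (X Y : V) (x : pt) : Prop := exists m K, (0 < m)%nat /\
  box (fun y => forall k, (K < k)%nat ->
    exists a b, val X k a y /\ val Y k b y /\ a + / INR m < b) x.

Lemma means_seq_lt d e X Y vX vY : den d e X vX -> den d e Y vY ->
  means d e (seq_lt X Y) (seqLtV vX vY).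
Proof.
  intros HX HY. eapply means_iff; [unfold seq_lt; meaning|intros z]. split.
  - intros (m & Hm & K & _ & H). exists m, K. split; [exact Hm|].
    apply (box1 _ _ _ H). clear z H. intros y H k Hk. apply box_elim in H.
    destruct (box_elim _ _ (H k I) (proj2 (mem_hat_hat _ _ _) Hk))
      as (p & q & r & s & Mp & Mq & (m' & Hm' & E & Er) &
          (a & w & t & Ha & Hw & Ht & Et & Ep & Ew & Es) & (t' & b & Ht' & Hb & L & Es' & Eq)).
    apply hat_inj in E. subst m'.
    apply (ratV_eq _ _ _ _ Hw Ew) in Er. apply (ratV_eq _ _ _ _ Ht Es) in Es'. subst.
    exists a, b. repeat split; auto; eapply memV_pair_r; eauto.
  - intros (m & K & Hm & H). exists m. split; [exact Hm|]. exists K. split; [exact I|].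
    apply (box1 _ _ _ H). clear z H. intros y H k _. apply (box1 _ _ _ H). clear y H.
    intros y H Hk. apply mem_hat_hat in Hk. apply box_elim in H.
    destruct (H k Hk) as (a & b & [Ha Ma] & [Hb Mb] & L).
    assert (Q := rational_inv m Hm).
    exists (ratV a), (ratV b), (ratV (/ INR m)), (ratV (a + / INR m)).
    split; [auto|split; [auto|split; [|split]]].
    + exists m. auto using eqV_refl.
    + exists a, (/ INR m), (a + / INR m). repeat split; auto using eqV_refl, rational_add.
    + exists (a + / INR m), b. repeat split; auto using eqV_refl, rational_add.
Qed.
Hint Extern 1 (means _ _ (seq_lt _ _) _) => rapply means_seq_lt : means.

Definition distLtV (a b e : V) (x : pt) : Prop := exists s t X f Y g D C,
  memV s a x /\ memV t b x /\ seqmodV X f s x /\ seqmodV Y g t x /\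
  distSeqV X Y D x /\ constSeqV e C x /\ seqLtV D C x.

Lemma means_real_dist_lt d e x y eps vx vy ve : den d e x vx -> den d e y vy -> den d e eps ve ->
  means d e (real_dist_lt x y eps) (distLtV vx vy ve).
Proof.
  by_meaning real_dist_lt. split.
  - intros (s & Hs & t & Ht & X & f & Y & g & D & C & Hr). exists s, t, X, f, Y, g, D, C. tauto.
  - intros (s & t & X & f & Y & g & D & C & Hs & Ht & Hr). exists s. split; auto.
    exists t. split; auto. exists X, f, Y, g, D, C. tauto.
Qed.
Hint Extern 1 (means _ _ (real_dist_lt _ _ _) _) => rapply means_real_dist_lt : means.

Lemma constSeqV_val u C k x : rational u -> constSeqV (ratV u) C x -> val C k u x.
Proof. intros Hu [_ H]. apply box_elim in H. split; [auto|apply H]. Qed.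

Lemma distLtV_repr a b u x : rational u -> distLtV a b (ratV u) x ->
  exists s t r r', memV s a x /\ memV t b x /\ repr s r x /\ repr t r' x /\ Rabs (r - r') < u.
Proof.
  intros Hu (s & t & X & f & Y & g & D & C & Hs & Ht & HX & HY & HD & HC & m & K & Hm & L).
  destruct (repr_exists s x) as [r Hr]; [now exists X, f|].
  destruct (repr_exists t x) as [r' Hr']; [now exists Y, g|].
  exists s, t, r, r'. do 4 (split; [assumption|]).
  apply (repr_conv _ _ _ _ _ HX) in Hr. apply (repr_conv _ _ _ _ _ HY) in Hr'.
  assert (P : 0 < / INR m) by now apply Rinv_0_lt_compat, INR_pos.
  destruct (Hr (/ INR m / 2)) as [K1 H1]; [lra|]. destruct (Hr' (/ INR m / 2)) as [K2 H2]; [lra|].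
  set (k := S (max K (max K1 K2))).
  apply box_elim in L. destruct (L k) as (d & c & Hd & Hc & Lt); [lia|].
  assert (GC : funD natD ratD C x) by apply HC.
  rewrite (val_unique _ _ _ _ _ GC Hc (constSeqV_val _ _ _ _ Hu HC)) in Lt.
  destruct HD as [GD HD]. apply box_elim in HD. destruct (HD k) as (p & q & Hp & Hq & Hpq).
  rewrite (val_unique _ _ _ _ _ GD Hd Hpq) in Lt.
  specialize (H1 k p ltac:(lia) Hp). specialize (H2 k q ltac:(lia) Hq).
  apply Rabs_def2 in H1, H2. assert (Lt' : Rabs (p - q) < u - / INR m) by lra.
  apply Rabs_def2 in Lt'. apply Rabs_def1; lra.
Qed.

(** Closeness of the limits at all points of a neighbourhood gives the internal
    inequality; the moduli at [x] again provide the index that serves for the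
    whole neighbourhood. *)
Lemma distLtV_of_repr a b s t u v x : rational u -> v < u ->
  memV s a x -> memV t b x ->
  box (fun y => exists r r', repr s r y /\ repr t r' y /\ Rabs (r - r') <= v) x ->
  distLtV a b (ratV u) x.
Proof.
  intros Hu Lv Hs Ht H.
  pose proof (box_elim _ _ H) as (_ & _ & (X & f & HX & _) & (Y & g & HY & _) & _).
  pose (D := funV natD ratD (fun k q y => exists a b, val X k a y /\ val Y k b y /\ q = Rabs (a - b))).
  pose (C := funV natD ratD (fun k q y => q = u)).
  exists s, t, X, f, Y, g, D, C.
  do 4 (split; [assumption|]).
  assert (OX := seqmodV_box _ _ _ _ HX). assert (OY := seqmodV_box _ _ _ _ HY).
  destruct HX as [EX HX], HY as [EY HY].
  assert (DV : forall y k p q, val X k p y -> val Y k q y -> val D k (Rabs (p - q)) y).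
  { intros y k p q Hp Hq. assert (Q := rational_dist p q (proj1 Hp) (proj1 Hq)).
    split; auto. apply (mem_funV_name natD ratD _ k _ y I Q).
    apply (box2 _ _ _ _ (val_box _ _ _ _ Hp) (val_box _ _ _ _ Hq)).
    intros z Hz Hz'. apply box_elim in Hz, Hz'. eauto. }
  assert (CV : forall y k, val C k u y).
  { intros y k. split; auto. apply (mem_funV_name natD ratD _ k _ y I Hu). now apply box_all. }
  split; [|split; [|]].
  - split.
    + apply funD_funV. apply (box2 _ _ _ _ HX HY). intros y HXy HYy k _.
      apply box_elim in HXy, HYy. destruct HXy as [HXy _], HYy as [HYy _].
      destruct (val_total X k y HXy) as [p Hp], (val_total Y k y HYy) as [q Hq].
      assert (Q := rational_dist p q (proj1 Hp) (proj1 Hq)).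
      exists (Rabs (p - q)). split; [exact Q|]. split.
      * apply (box2 _ _ _ _ (val_box _ _ _ _ Hp) (val_box _ _ _ _ Hq)).
        intros z Hz Hz'. apply box_elim in Hz, Hz'. eauto.
      * intros w _ Hw. apply box_elim in Hw. destruct Hw as (p' & q' & Hp' & Hq' & ->).
        now rewrite (val_unique _ _ _ _ _ HXy Hp Hp'), (val_unique _ _ _ _ _ HYy Hq Hq').
    + apply (box2 _ _ _ _ HX HY). intros y HXy HYy k.
      apply box_elim in HXy, HYy. destruct HXy as [HXy _], HYy as [HYy _].
      destruct (val_total X k y HXy) as [p Hp], (val_total Y k y HYy) as [q Hq].
      exists p, q. auto.
  - split.
    + apply funD_funV, box_all. intros y k _. exists u. split; [exact Hu|].
      split; [now apply box_all|]. intros w _. apply box_elim.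
    + apply box_all. intros y k. apply CV.
  (* The two terms differ by at most [v + 2 / m] and [seq_lt] demands a further
     [1 / m], so that a fifth of the gap is enough room. *)
  - destruct (inv_small ((u - v) / 5)) as (m & Hm & Lm); [lra|].
    assert (P : 0 < / INR m) by now apply Rinv_0_lt_compat, INR_pos.
    destruct (modulated_small X f x (/ INR m)) as (w & K & Hw & Pw & M); [apply box_elim, HX|lra|].
    destruct (modulated_small Y g x (/ INR m)) as (w' & K' & Hw' & Pw' & M'); [apply box_elim, HY|lra|].
    exists m, (max K K'). split; auto.
    apply memV_box in M, M'.
    apply (box3 _ _ _ _ _ (box_and _ _ _ OX OY) H (box_and _ _ _ M M')).
    intros y Hy Hr Hk k Lk. apply box_elim in Hy. destruct Hy as [BX BY].
    apply box_elim in Hr, Hk. destruct Hr as (r & r' & Rs & Rt & Lr), Hk as [My My'].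
    apply (repr_conv _ _ _ _ _ BX) in Rs. apply (repr_conv _ _ _ _ _ BY) in Rt.
    destruct BX as [_ BX], BY as [_ BY]. apply box_elim in BX, BY.
    destruct (val_total X k y) as [p Hp]; [apply BX|].
    destruct (val_total Y k y) as [q Hq]; [apply BY|].
    exists (Rabs (p - q)), u. split; [auto|split; [auto|]].
    assert (L1 : Rabs (p - r) <= w) by (apply (modulated_rate X f y r w K k); auto; lra || lia).
    assert (L2 : Rabs (q - r') <= w') by (apply (modulated_rate Y g y r' w' K' k); auto; lra || lia).
    assert (T : Rabs (p - q) <= w + v + w').
    { replace (p - q) with ((p - r) + (r - r') + (r' - q)) by ring.
      rewrite (Rabs_minus_sym q r') in L2.
      pose proof (Rabs_triang (p - r + (r - r')) (r' - q)).
      pose proof (Rabs_triang (p - r) (r - r')). lra. }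
    lra.
Qed.

Definition realSeqV (h : V) (x : pt) : Prop :=
  box (fun y => forall p, memV p h y ->
     exists k v, realP v y /\ eqV p (pairV (hat k) v) y) x /\
  box (fun y => forall k, exists v, memV (pairV (hat k) v) h y /\
     box (fun z => forall w, memV (pairV (hat k) w) h z -> eqV w v z) y) x.

Lemma means_is_realseq d e h vh : den d e h vh -> means d e (is_realseq h) (realSeqV vh).
Proof.
  intros Hh. eapply means_iff; [unfold is_realseq, is_fun, fex_unique; meaning|intros z].
  split; (intros [H1 H2]; split).
  - apply (box1 _ _ _ H1). intros y Hy p Hp. apply box_elim in Hy.
    destruct (box_elim _ _ (Hy p) Hp) as (k & _ & v & Hv & E). eauto.
  - revert H2. apply box_mono. intros y Hy k. destruct (Hy k I) as (v & Hv & Hu).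
    exists v. split; auto. revert Hu. apply box_mono. intros u Hu w. apply (box_elim _ _ (Hu w)).
  - apply (box1 _ _ _ H1). intros y Hy p. apply (box1 _ _ _ Hy). intros u Hu Hp.
    apply box_elim in Hu. destruct (Hu p Hp) as (k & v & Hv & E). exists k.
    split; [exact I|]. eauto.
  - revert H2. apply box_mono. intros y Hy k _. destruct (Hy k) as (v & Hv & Hu).
    exists v. split; auto. apply (box1 _ _ _ Hu). intros u Hu' w. revert Hu'.
    apply box_mono. auto.
Qed.
Hint Extern 1 (means _ _ (is_realseq _) _) => rapply means_is_realseq : means.

Definition cauchyRealSeqV (h : V) (x : pt) : Prop := realSeqV h x /\
  box (fun y => forall u, rational u -> 0 < u -> exists K, box (fun z => forall j k,
    (K < j)%nat -> (K < k)%nat ->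
    exists a b, memV (pairV (hat j) a) h z /\ memV (pairV (hat k) b) h z /\
                distLtV a b (ratV u) z) y) x.

Lemma means1_is_cauchy_realseq d e : means1 d e is_cauchy_realseq cauchyRealSeqV.
Proof.
  apply means1_intro. intros d' e' _ h vh Hh.
  eapply means_iff; [unfold is_cauchy_realseq; meaning|intros z].
  split; intros [H1 H2]; (split; [exact H1|]).
  - revert H2. apply box_mono. intros y Hy u Hu Pu. destruct (Hy u (conj Hu Pu)) as (K & _ & HK).
    exists K. apply (box1 _ _ _ HK). clear y Hy HK. intros y HK j k Hj Hk.
    pose proof (box_elim _ _ (box_elim _ _ HK j I) k I) as K1.
    pose proof (box_elim _ _ K1 (proj2 (mem_hat_hat _ _ _) Hj)) as K2.
    exact (box_elim _ _ K2 (proj2 (mem_hat_hat _ _ _) Hk)).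
  - revert H2. apply box_mono. intros y Hy u [Hu Pu]. destruct (Hy u Hu Pu) as (K & HK).
    exists K. split; [exact I|].
    apply (box1 _ _ _ HK). clear y Hy HK. intros y HK j _.
    apply (box1 _ _ _ HK). clear y HK. intros y HK k _.
    apply (box1 _ _ _ HK). clear y HK. intros y HK Hj. apply mem_hat_hat in Hj.
    apply (box1 _ _ _ HK). clear y HK. intros y HK Hk. apply mem_hat_hat in Hk.
    apply box_elim in HK. now apply HK.
Qed.
Hint Extern 1 (means1 _ _ is_cauchy_realseq _) => rapply means1_is_cauchy_realseq : means.

Definition limitV (h y : V) (x : pt) : Prop := realP y x /\
  box (fun z => forall u, rational u -> 0 < u -> exists K, box (fun w => forall j, (K < j)%nat ->
    exists a, memV (pairV (hat j) a) h w /\ distLtV a y (ratV u) w) z) x.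

Lemma means_is_limit d e h y vh vy : den d e h vh -> den d e y vy ->
  means d e (is_limit h y) (limitV vh vy).
Proof.
  intros Hh Hy. eapply means_iff; [unfold is_limit; meaning|intros z].
  split; intros [H1 H2]; (split; [exact H1|]); revert H2; apply box_mono; intros w H2 u.
  - intros Hu Pu. destruct (H2 u (conj Hu Pu)) as (K & _ & HK). exists K.
    apply (box1 _ _ _ HK). clear w H2 HK. intros w HK j Hj.
    exact (box_elim _ _ (box_elim _ _ HK j I) (proj2 (mem_hat_hat _ _ _) Hj)).
  - intros [Hu Pu]. destruct (H2 u Hu Pu) as (K & HK). exists K. split; [exact I|].
    apply (box1 _ _ _ HK). clear w H2 HK. intros w HK j _.
    apply (box1 _ _ _ HK). clear w HK. intros w HK Hj. apply mem_hat_hat in Hj.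
    apply box_elim in HK. now apply HK.
Qed.
Hint Extern 1 (means _ _ (is_limit _ _) _) => rapply means_is_limit : means.

Lemma force_cauchy_completeness e x h :
  force cauchy_completeness e x -> cauchyRealSeqV h x -> exists y, limitV h y x.
Proof.
  intros F Hh.
  assert (M : means 0 e (∀[is_cauchy_realseq] h, ∃ y, is_limit h y)%fml
    (box (fun y => forall h, box (fun z => cauchyRealSeqV h z -> exists v, limitV h v z) y)))
    by meaning.
  apply (means_force _ _ _ _ _ M) in F.
  exact (box_elim _ _ (box_elim _ _ F h) Hh).
Qed.

(** * Liftable functions *)

(** Near [x], the function [F] is the limit of locally constant rational
    functions, at the fixed rate [1 / (m + 1)]. *)
Definition liftable (F : pt -> R) (x : pt) : Prop := exists sigma : pt -> nat -> R,
  box (fun y => forall m, rational (sigma y m) /\ box (fun z => sigma z m = sigma y m) y /\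
                          Rabs (sigma y m - F y) <= / INR (S m)) x.

(** The fixed rate of convergence supplies a constant modulus. *)
Lemma liftable_repr F x : liftable F x -> exists s, box (fun y => repr s (F y) y) x.
Proof.
  intros [sigma H].
  destruct (choice (fun u K => 0 < u -> / INR (S K) < u / 2)) as [Kof HKof].
  { intros u. destruct (Rlt_le_dec 0 u) as [P|P]; [|exists 0%nat; lra].
    destruct (inv_small (u / 2)) as ([|m] & Hm & L); [lra|lia|now exists m]. }
  set (X := funV natD ratD (fun k q y => q = sigma y k)).
  set (f := funV posratD natD (fun u K y => K = Kof u)).
  exists (pairV X f). apply (box1 _ _ _ H). clear x H. intros x H.
  assert (VX : forall y k q, val X k q y -> q = sigma y k).
  { intros y k q [Hq M]. apply (mem_funV_name natD ratD _ k q y I Hq), box_elim in M. exact M. }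
  assert (Rate : forall u k, 0 < u -> (Kof u < k)%nat -> / INR (S k) < u / 2).
  { intros u k Pu Hk. apply Rle_lt_trans with (/ INR (S (Kof u))); auto.
    apply Rinv_le_contravar; [apply INR_pos; lia|apply le_INR; lia]. }
  exists X, f. split; [split; [apply eqV_refl|]|].
  - apply (box1 _ _ _ H). clear x H. intros x H. split; [|split].
    + apply funD_funV. revert H. apply box_mono. intros y H k _.
      destruct (H k) as (Q & L & _). exists (sigma y k). split; [exact Q|]. split.
      * revert L. apply box_mono. auto.
      * intros q _. apply box_elim.
    + apply funD_funV, box_all. intros y u _. exists (Kof u). split; [exact I|].
      split; [now apply box_all|]. intros K _. apply box_elim.
    + intros u K Hu Pu M m n r s Hm Hn Hr Hs.
      apply (mem_funV_name posratD natD _ u K x (conj Hu Pu) I), box_elim in M. subst K.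
      apply VX in Hr, Hs. subst. apply box_elim in H.
      destruct (H m) as (_ & _ & Dm), (H n) as (_ & _ & Dn).
      pose proof (Rate u m Pu Hm). pose proof (Rate u n Pu Hn).
      pose proof (Rabs_triang (sigma x m - F x) (F x - sigma x n)) as T.
      rewrite (Rabs_minus_sym (F x)) in T.
      replace (sigma x m - F x + (F x - sigma x n)) with (sigma x m - sigma x n) in T by ring.
      lra.
  - intros eps P. exists (Kof eps). intros k q Hk Hq. apply VX in Hq. subst.
    apply box_elim in H. destruct (H k) as (_ & _ & D). pose proof (Rate eps k P Hk). lra.
Qed.

(** The modulus selects, for each [m], a term of the sequence that is within
    [1 / (m + 1)] of the limit; both the modulus and the term are locally
    constant, hence so is the selected value. *)
Lemma repr_liftable F s x : box (fun y => repr s (F y) y) x -> liftable F x.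
Proof.
  intros H. pose proof (box_elim _ _ H) as (X & f & HX & _). apply seqmodV_box in HX.
  pose (Good := fun (c : pt * nat) q => exists K,
    memV (pairV (ratV (/ INR (S (snd c)))) (hat K)) f (fst c) /\ val X (S K) q (fst c)).
  destruct (choice (fun c q => (exists q, Good c q) -> Good c q)) as [sg Hsg].
  { intros c. destruct (classic (exists q, Good c q)) as [[q Hq]|C]; [now exists q|].
    exists 0. tauto. }
  assert (Pos : forall m, rational (/ INR (S m)) /\ 0 < / INR (S m)).
  { intros m. split; [apply rational_inv; lia|]. apply Rinv_0_lt_compat, INR_pos. lia. }
  assert (Ex : forall y m, box (seqmodV X f s) y -> Good (y, m) (sg (y, m))).
  { intros y m Hy. apply Hsg. apply box_elim in Hy. destruct Hy as [_ Hy].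
    apply box_elim in Hy. destruct Hy as (G1 & G2 & _).
    destruct (funD_total posratD natD f y _ G2 (Pos m)) as (K & _ & M).
    destruct (val_total X (S K) y G1) as [q Hq]. exists q, K. auto. }
  exists (fun y m => sg (y, m)). apply (box2 _ _ _ _ H HX). clear x H HX.
  intros y H HX m. destruct (Ex y m HX) as (K & M & Hq). simpl in M, Hq.
  split; [apply Hq|split].
  - apply (box3 _ _ _ _ _ HX (memV_box _ _ _ M) (val_box _ _ _ _ Hq)).
    intros z HX' M' Hq'. apply box_elim in M', Hq'.
    destruct (Ex z m HX') as (K' & M'' & Hq''). simpl in M'', Hq''.
    apply box_elim in HX'. destruct HX' as [_ G]. apply box_elim in G.
    destruct G as (G1 & G2 & _).
    assert (K = K') as <- by exact (funD_unique posratD natD f z _ K K' G2 (Pos m) I I M' M'').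
    now apply (val_unique X (S K) z).
  - apply box_elim in H, HX. apply (repr_conv _ _ _ _ _ HX) in H. destruct HX as [_ G].
    apply box_elim in G. apply (modulated_rate X f y _ _ K (S K)); auto; apply Pos.
Qed.

Definition realSeqName (G : nat -> pt -> R) : V :=
  mk nat (fun j => pairV (hat j) (realV (G j))) (fun _ _ => True).

Lemma mem_realSeqName G j v x :
  memV (pairV (hat j) v) (realSeqName G) x <-> eqV v (realV (G j)) x.
Proof.
  split.
  - intros (k & _ & E). apply pairV_inj in E as [E1 E2]. now apply hat_inj in E1 as ->.
  - intros E. exists j. split; [now apply box_all|]. apply pairV_congr; auto using eqV_refl.
Qed.

Lemma seq_inv_le K j : (K < j)%nat -> / INR (S j) <= / INR (S K).
Proof. intros H. apply Rinv_le_contravar; [apply INR_pos; lia|apply le_INR; lia]. Qed.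

Section Limit.
Variables (G : nat -> pt -> R) (F : pt -> R).
Hypothesis G_liftable : forall j x, liftable (G j) x.
Hypothesis G_near : forall j x, Rabs (G j x - F x) <= / INR (S j).

Lemma cauchy_realSeqName x : cauchyRealSeqV (realSeqName G) x.
Proof.
  split; [split|]; apply box_all; clear x; intros x.
  - intros p (j & _ & E). exists j, (realV (G j)). split; [|exact E].
    apply realP_realV, liftable_repr, G_liftable.
  - intros k. exists (realV (G k)). rewrite mem_realSeqName. split; [apply eqV_refl|].
    apply box_all. intros z w. apply mem_realSeqName.
  - intros u Hu Pu. destruct (inv_small (u / 2)) as ([|K] & HK & L); [lra|lia|].
    exists K. apply box_all. clear x. intros x j k Hj Hk.
    exists (realV (G j)), (realV (G k)). rewrite !mem_realSeqName.
    split; [apply eqV_refl|]. split; [apply eqV_refl|].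
    destruct (liftable_repr _ _ (G_liftable j x)) as [s Hs].
    destruct (liftable_repr _ _ (G_liftable k x)) as [t Ht].
    apply (distLtV_of_repr _ _ s t u (2 * / INR (S K))); auto; [lra|now apply mem_realV|now apply mem_realV|].
    apply (box2 _ _ _ _ Hs Ht). intros y Hy Hy'. apply box_elim in Hy, Hy'.
    exists (G j y), (G k y). split; [auto|split; [auto|]].
    pose proof (G_near j y). pose proof (G_near k y).
    pose proof (seq_inv_le K j Hj). pose proof (seq_inv_le K k Hk).
    pose proof (Rabs_triang (G j y - F y) (F y - G k y)) as T.
    rewrite (Rabs_minus_sym (F y)) in T.
    replace (G j y - F y + (F y - G k y)) with (G j y - G k y) in T by ring. lra.
Qed.

(** Wherever [v] is the limit, each of its elements represents the pointwise
    limit of the [G j], which is [F]. *)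
Lemma limit_liftable v x : limitV (realSeqName G) v x -> liftable F x.
Proof.
  intros [(s & (X & f & Hs) & Hv) HL]. apply (repr_liftable F s).
  apply (box3 _ _ _ _ _ (seqmodV_box _ _ _ _ Hs) Hv HL). clear x Hs Hv HL.
  intros y Hs Hv HL. apply box_elim in Hs, Hv, HL.
  destruct (repr_exists s y) as [r Hr]; [now exists X, f|].
  assert (r = F y) as <-; [|exact Hr].
  apply cond_eq. intros eps P.
  destruct (inv_small (eps / 2)) as (m & Hm & L); [lra|].
  assert (Pm : 0 < / INR m) by now apply Rinv_0_lt_compat, INR_pos.
  destruct (HL (/ INR m) (rational_inv m Hm) Pm) as [K HK]. apply box_elim in HK.
  destruct (HK (S (max K m))) as (a & Ha & HD); [lia|].
  apply mem_realSeqName in Ha.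
  apply distLtV_repr in HD as (t & t' & r1 & r2 & Ht & Ht' & R1 & R2 & D);
    [|now apply rational_inv].
  apply (memV_r _ _ _ _ Ha), mem_realV, box_elim in Ht.
  rewrite (repr_unique _ _ _ _ R1 Ht) in D.
  apply Hv in Ht' as [_ Ht']. apply (equivV_repr _ _ _ _ Ht') in Hr.
  rewrite (repr_unique _ _ _ _ R2 Hr) in D.
  pose proof (G_near (S (max K m)) y) as N1.
  assert (N2 : / INR (S (S (max K m))) <= / INR m).
  { apply Rinv_le_contravar; [now apply INR_pos|apply le_INR; lia]. }
  set (g := G (S (max K m)) y) in *.
  assert (D' : Rabs (g - F y) < eps / 2) by lra.
  assert (D'' : Rabs (g - r) < eps / 2) by lra.
  apply Rabs_def2 in D', D''. apply Rabs_def1; lra.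
Qed.

Theorem completeness_lifts :
  proves Intuitionistic IZF_Ref cauchy_completeness -> forall x, liftable F x.
Proof.
  intros H x.
  assert (Fc : force cauchy_completeness (fun _ => emptyV) x).
  { apply (soundness _ _ _ force_IZF_Ref H). intros q []. }
  destruct (force_cauchy_completeness _ _ _ Fc (cauchy_realSeqName x)) as [v Hv].
  now apply limit_liftable with v.
Qed.
End Limit.

End Forcing.

(** * A space with a uniform limit that does not lift *)

Local Open Scope R_scope.

(** [isolated k r] and [cluster k r] are the points of level [k] with
    coordinate [r]. *)
Inductive point : Set :=
| apex : point
| isolated (k : nat) (r : R)
| cluster (k : nat) (r : R).

Definition nbhd (x : point) (n : nat) (y : point) : Prop :=
  match x, y with
  | apex, apex => True
  | apex, isolated k _ | apex, cluster k _ => (n <= k)%nat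
  | isolated k r, _ => y = x
  | cluster k r, isolated k' r' => k' = k /\ Rabs (r' - r) < / INR (S n)
  | cluster k r, _ => y = x
  end.

Lemma inv_S_le m n : (m <= n)%nat -> / INR (S n) <= / INR (S m).
Proof. intros H. apply Rinv_le_contravar; [apply INR_pos; lia|apply le_INR; lia]. Qed.

Lemma inv_S_pos n : 0 < / INR (S n).
Proof. apply Rinv_0_lt_compat, INR_pos. lia. Qed.

Lemma nbhd_refl x n : nbhd x n x.
Proof. destruct x; simpl; auto. Qed.

Lemma nbhd_anti x n m y : (n <= m)%nat -> nbhd x m y -> nbhd x n y.
Proof.
  intros L. pose proof (inv_S_le n m L).
  destruct x, y; cbn [nbhd]; auto; try lia. intros [E D]. split; auto. lra.
Qed.

Lemma nbhd_open x n y : nbhd x n y -> exists m, forall z, nbhd y m z -> nbhd x n z.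
Proof.
  intros H. destruct x as [|k r|k r], y as [|k' r'|k' r']; cbn [nbhd] in H.
  - now exists n.
  - exists 0%nat. intros z ->. exact H.
  - exists 0%nat. intros [|k'' r''|k'' r''] Hz; cbn [nbhd] in Hz; try discriminate.
    + destruct Hz as [-> _]. exact H.
    + injection Hz as -> ->. exact H.
  - discriminate.
  - injection H as -> ->. now exists n.
  - discriminate.
  - discriminate.
  - exists 0%nat. intros z ->. exact H.
  - injection H as -> ->. now exists n.
Qed.

Notation lifts := (liftable point nbhd).

Lemma approximation : exists approx : R -> nat -> R, forall r m,
  rational (approx r m) /\ Rabs (approx r m - r) <= / INR (S m) / 2.
Proof.
  destruct (choice (fun (p : R * nat) q =>
    rational q /\ Rabs (q - fst p) <= / INR (S (snd p)) / 2)) as [f Hf].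
  2: { exists (fun r m => f (r, m)). intros r m. apply (Hf (r, m)). }
  intros [r m]. cbn [fst snd]. set (c := (2 * S m)%nat).
  assert (Hc : (0 < c)%nat) by lia. pose proof (INR_pos c Hc) as Pc.
  destruct (archimed (r * INR c)) as [A1 A2]. set (z := Rdefinitions.up (r * INR c)) in *.
  exists (IZR z / INR c). split.
  - exists (Z.to_nat z), (Z.to_nat (- z)), c. split; auto. unfold frac. f_equal.
    rewrite !INR_IZR_INZ, <- minus_IZR. f_equal. lia.
  - replace (/ INR (S m) / 2) with (/ INR c).
    2: { unfold c. rewrite mult_INR. simpl (INR 2). field. apply not_0_INR. lia. }
    replace (IZR z / INR c - r) with ((IZR z - r * INR c) * / INR c) by (field; lra).
    rewrite Rabs_mult, (Rabs_right (/ INR c)).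
    2: { apply Rle_ge, Rlt_le, Rinv_0_lt_compat, Pc. }
    rewrite <- (Rmult_1_l (/ INR c)) at 2. apply Rmult_le_compat_r.
    + apply Rlt_le, Rinv_0_lt_compat, Pc.
    + rewrite Rabs_right; lra.
Qed.

Lemma lifts_isolated H k r : lifts H (isolated k r).
Proof.
  destruct approximation as [approx A]. exists (fun y m => approx (H y) m).
  exists 0%nat. intros y -> m. destruct (A (H (isolated k r)) m) as [A1 A2].
  split; [exact A1|split].
  - exists 0%nat. intros z ->. reflexivity.
  - pose proof (inv_S_pos m). lra.
Qed.

(** Near [cluster k r] the [m]-th approximation takes the value of the centre
    wherever [H] is close to its value at the centre.  By the Lipschitz condition
    this happens on a neighbourhood of the centre; elsewhere only isolated points
    occur, at which the approximation is free. *)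
Lemma lifts_cluster H k r :
  (forall r', Rabs (H (isolated k r') - H (cluster k r)) <= Rabs (r' - r)) ->
  lifts H (cluster k r).
Proof.
  intros L. destruct approximation as [approx A].
  set (c := H (cluster k r)).
  exists (fun y m => if Rle_dec (Rabs (H y - c)) (/ INR (S m) / 2)
                     then approx c m else approx (H y) m).
  assert (C : forall m, Rabs (H (cluster k r) - c) <= / INR (S m) / 2).
  { intros m. fold c. rewrite Rminus_diag, Rabs_R0. pose proof (inv_S_pos m). lra. }
  exists 0%nat. intros y Hy m. pose proof (inv_S_pos m) as P.
  split; [destruct Rle_dec; apply A|split].
  - destruct y as [|k' r'|k' r']; cbn [nbhd] in Hy; try discriminate.
    + exists 0%nat. intros z ->. reflexivity.
    (* The radius [1 / (2 (m + 1) + 1)] is below the threshold [1 / (2 (m + 1))]. *)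
    + injection Hy as -> ->. exists (2 * S m)%nat. intros z Hz.
      destruct (Rle_dec (Rabs (H (cluster k r) - c)) _) as [_|N]; [|now destruct (N (C m))].
      destruct z as [|k' r'|k' r']; cbn [nbhd] in Hz; try discriminate.
      * destruct Hz as [-> D]. destruct Rle_dec as [_|N]; [reflexivity|]. destruct N.
        eapply Rle_trans; [apply L|]. apply Rlt_le, (Rlt_le_trans _ _ _ D).
        replace (/ INR (S m) / 2) with (/ INR (2 * S m)).
        2: { rewrite mult_INR. simpl (INR 2). field. apply not_0_INR. lia. }
        apply Rinv_le_contravar; [apply INR_pos; lia|apply le_INR; lia].
      * injection Hz as -> ->. destruct Rle_dec as [_|N]; [reflexivity|now destruct (N (C m))].
  - destruct Rle_dec as [D|_].
    + destruct (A c m) as [_ A2]. pose proof (Rabs_triang (approx c m - c) (c - H y)) as T.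
      rewrite (Rabs_minus_sym c) in T.
      replace (approx c m - c + (c - H y)) with (approx c m - H y) in T by ring. lra.
    + destruct (A (H y) m) as [_ A2]. lra.
Qed.

(** The coordinate, clipped to lie between [0] and [1 / (k + 1)]. *)
Definition ramp (k : nat) (r : R) : R := Rmax 0 (Rmin r (/ INR (S k))).
Definition height (x : point) : R :=
  match x with apex => 0 | isolated k r | cluster k r => ramp k r end.
Definition truncated (j : nat) (x : point) : R :=
  match x with
  | apex => 0
  | isolated k r | cluster k r => if Nat.ltb k j then ramp k r else 0
  end.

Lemma ramp_bounds k r : 0 <= ramp k r <= / INR (S k).
Proof.
  pose proof (inv_S_pos k). unfold ramp.
  split; [apply Rmax_l|apply Rmax_lub; [lra|apply Rmin_r]].
Qed.

Lemma ramp_lipschitz k r r' : Rabs (ramp k r - ramp k r') <= Rabs (r - r').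
Proof.
  pose proof (inv_S_pos k). unfold ramp, Rmax, Rmin.
  repeat destruct Rle_dec; unfold Rabs; repeat destruct Rcase_abs; lra.
Qed.

Lemma truncated_near j x : Rabs (truncated j x - height x) <= / INR (S j).
Proof.
  pose proof (inv_S_pos j).
  assert (K : forall k r, Rabs ((if Nat.ltb k j then ramp k r else 0) - ramp k r) <= / INR (S j)).
  { intros k r. destruct (Nat.ltb_spec k j) as [L|L].
    - rewrite Rminus_diag, Rabs_R0. lra.
    - pose proof (ramp_bounds k r). pose proof (inv_S_le j k L).
      rewrite Rabs_left1; lra. }
  destruct x; simpl truncated; simpl height; auto.
  rewrite Rminus_diag, Rabs_R0. lra.
Qed.

(** Below level [j] the truncation is the Lipschitz function [ramp]; it vanishes
    on the neighbourhood of the apex formed by the levels from [j] on. *)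
Lemma truncated_lifts j x : lifts (truncated j) x.
Proof.
  destruct x as [|k r|k r].
  - exists (fun _ _ => 0), j. intros y Hy m. split; [apply rational_0|split].
    + now exists 0%nat.
    + assert (truncated j y = 0) as ->.
      { destruct y as [|k r|k r]; simpl in *; auto; destruct (Nat.ltb_spec k j); auto; lia. }
      rewrite Rminus_diag, Rabs_R0. pose proof (inv_S_pos m). lra.
  - apply lifts_isolated.
  - apply lifts_cluster. intros r'. simpl. destruct Nat.ltb; [apply ramp_lipschitz|].
    rewrite Rminus_diag, Rabs_R0. apply Rabs_pos.
Qed.

(** The derivative vanishes everywhere. *)
Lemma locally_constant_constant (g : R -> R) :
  (forall r, exists d : posreal, forall r', Rabs (r' - r) < d -> g r' = g r) ->
  forall r s, g r = g s.
Proof.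
  intros H. assert (D : forall r, derivable_pt_lim g r 0).
  { intros r eps P. destruct (H r) as [d Hd]. exists d. intros h Hh Hd'.
    rewrite Hd by (now replace (r + h - r) with h by ring).
    rewrite !Rminus_diag. unfold Rdiv. now rewrite Rmult_0_l, Rminus_0_r, Rabs_R0. }
  pose (pr := fun r => exist (derivable_pt_abs g r) 0 (D r)).
  intros r s. apply (null_derivative_1 g pr). intros x. reflexivity.
Qed.

(** A lift at the apex gives locally constant approximations on a whole level
    [k], which are constant along the line of isolated points; but [height] takes
    both values [0] and [1 / (k + 1)] there. *)
Lemma height_not_liftable : ~ lifts height apex.
Proof.
  (* With this [m] the two errors of [1 / (m + 1)] are together less than the
     difference [1 / (k + 1)] of the values. *)
  intros (sigma & k & H). set (m := (2 * S k)%nat).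
  pose (g := fun r => sigma (isolated k r) m).
  assert (C : forall r s, g r = g s).
  { apply locally_constant_constant. intros r.
    destruct (H (cluster k r) (Nat.le_refl k) m) as (_ & [n Hn] & _).
    exists (mkposreal _ (inv_S_pos n)). intros r' Hr'. simpl pos in Hr'. unfold g.
    rewrite (Hn (isolated k r')), (Hn (isolated k r)); auto; split; auto.
    rewrite Rminus_diag, Rabs_R0. apply inv_S_pos. }
  destruct (H (isolated k 0) (Nat.le_refl k) m) as (_ & _ & D0).
  destruct (H (isolated k (/ INR (S k))) (Nat.le_refl k) m) as (_ & _ & D1).
  fold (g 0) in D0. fold (g (/ INR (S k))) in D1.
  rewrite (C (/ INR (S k)) 0) in D1. cbn [height] in D0, D1.
  pose proof (inv_S_pos k) as P.
  assert (E0 : ramp k 0 = 0).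
  { unfold ramp. rewrite Rmin_left by lra. apply Rmax_left. lra. }
  assert (E1 : ramp k (/ INR (S k)) = / INR (S k)).
  { unfold ramp. rewrite Rmin_left by lra. apply Rmax_right. lra. }
  rewrite E0 in D0. rewrite E1 in D1.
  assert (L : 2 * / INR (S m) < / INR (S k)).
  { assert (Pm : 0 < INR (S m)) by (apply INR_pos; lia).
    assert (Pk : 0 < INR (S k)) by (apply INR_pos; lia).
    apply Rmult_lt_reg_r with (INR (S m)); [exact Pm|].
    apply Rmult_lt_reg_r with (INR (S k)); [exact Pk|].
    replace (2 * / INR (S m) * INR (S m) * INR (S k)) with (2 * INR (S k)) by (field; lra).
    replace (/ INR (S k) * INR (S m) * INR (S k)) with (INR (S m)) by (field; lra).
    change 2 with (INR 2). rewrite <- mult_INR. apply lt_INR. lia. }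
  unfold Rabs in D0, D1. repeat destruct Rcase_abs; lra.
Qed.

(** The truncations of [height] are liftable and converge to it uniformly, so
    completeness would make [height] liftable at the apex. *)
Theorem theorem6p1 (ZF_consistent : consistent Classical ZF) :
  ~ proves Intuitionistic IZF_Ref cauchy_completeness.
Proof.
  intros H. apply height_not_liftable.
  exact (completeness_lifts point nbhd nbhd_refl nbhd_anti nbhd_open truncated height
           truncated_lifts truncated_near H apex).
Qed.
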